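(* Let $0<\phi_0<\phi_1<\frac{\pi}{2}$ and let $k\ge1$ be an integer. For $j\in\{k,k+1\}$ put $T_{*j}:=(4j+1)T(\phi_1)+T_1(\phi_1,\phi_0)$, and put $T_k^*:=(4k+3)T(\phi_1)-T_1(\phi_1,\phi_0)$. For $\alpha\in(\phi_1,\frac{\pi}{2})$ put $$\begin{aligned} T_{A}(\alpha)&:=4kT(\alpha)+T_1(\alpha,\phi_0)+T_1(\alpha,\phi_1),\\ T_{C_r}(\alpha)&:=(4k+2)T(\alpha)+T_1(\alpha,\phi_0)-T_1(\alpha,\phi_1),\\ T_{C_\ell}(\alpha)&:=(4k+2)T(\alpha)-T_1(\alpha,\phi_0)+T_1(\alpha,\phi_1),\\ T_{D}(\alpha)&:=4(k+1)T(\alpha)-T_1(\alpha,\phi_0)-T_1(\alpha,\phi_1). \end{aligned}$$ Then: (a) $T_k^*<T_{*(k+1)}$; (b) $T_{*k}<T_k^*$; (c) $T_{C_r}(\alpha)>T_{*k}$ and $T_D(\alpha)>T_k^*$ for all $\alpha\in(\phi_1,\frac{\pi}{2})$; (d) $T_{C_\ell}(\alpha)$ is a convex function of $\tilde\alpha=\sin^2\alpha\in(\sin^2\phi_1,1)$, tends to $+\infty$ as $\alpha\to\frac{\pi}{2}$, has exactly one local extremum in $(\phi_1,\frac{\pi}{2})$, which is a minimum, and satisfies $T_{C_\ell}(\alpha)<T_k^*$ for all sufficiently small $\alpha-\phi_1>0$; (e) for $\alpha-\phi_1>0$ sufficiently small, type $A$ orbits satisfy $T_A(\alpha)<T_{*k}$,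 and the corresponding branch in the diagram of $L$ versus $y(-L)$ is convex; moreover $T_A(\alpha)\to+\infty$ as $\alpha\to\frac{\pi}{2}$, and the branch of type $A$ solutions has a saddle-node, which is unique by convexity.
   Context: For $\alpha\in(0,\frac{\pi}{2})$ define $T(\alpha):=\int_0^{\alpha}\frac{dx}{\sqrt{\cos 2x-\cos 2\alpha}}$, and for $0<\phi\le\alpha$ define $T_1(\alpha,\phi):=\int_0^{\phi}\frac{dx}{\sqrt{\cos 2x-\cos 2\alpha}}$ (these are convergent, possibly improper, integrals; $T_1(\alpha,\alpha)=T(\alpha)$). Consider the boundary value problem $x'=y$, $y'=-\sin 2x$ on $[-L,L]$ with $x(-L)=-\phi_0$, $x(L)=\phi_1$, where $L>0$ is the bifurcation parameter. For $\alpha\in(\phi_1,\frac{\pi}{2})$ the type $A$ orbit (with winding number $k$) is the one lying on the closed curve $y^2-\cos 2x=-\cos 2\alpha$ that starts on the line $x=-\phi_0$ with $y(-L)>0$, makes $k$ full turns around the origin, and then continues to end on the line $x=\phi_1$ with $y(L)>0$; it takes time $2L=T_A(\alpha)$. The branch of type $A$ solutions in the diagram of $L$ versus $y(-L)$ is the curve of points $(L,y(-L))$ given by these orbits as $\alpha$ varies in $(\phi_1,\frac{\pi}{2})$, so that $L=\frac12T_A(\alpha)$ and $y(-L)=\sqrt{\cos 2\phi_0-\cos 2\alpha}$. A saddle-node of the branch is a point at which the branch folds back with respect to $L$ (here, its leftmost point, where $L$ is minimal along the branch). *)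

(* Defs.v *)
From Stdlib Require Import Reals.
From Coquelicot Require Import Coquelicot.
Open Scope R_scope.

(* The upper end point is approached from the left, so the integral is improper
   when [phi = alpha] and is the usual Riemann integral when [phi < alpha]. *)
Definition T1 (alpha phi : R) : R :=
  RInt_gen (fun x => / sqrt (cos (2 * x) - cos (2 * alpha)))
    (at_point 0) (at_left phi).

Definition T (alpha : R) : R := T1 alpha alpha.

Definition T_lower_star (phi0 phi1 : R) (j : nat) : R :=
  (4 * INR j + 1) * T phi1 + T1 phi1 phi0.

Definition T_upper_star (phi0 phi1 : R) (k : nat) : R :=
  (4 * INR k + 3) * T phi1 - T1 phi1 phi0.

Definition T_A (phi0 phi1 : R) (k : nat) (alpha : R) : R :=
  4 * INR k * T alpha + T1 alpha phi0 + T1 alpha phi1.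

Definition T_Cr (phi0 phi1 : R) (k : nat) (alpha : R) : R :=
  (4 * INR k + 2) * T alpha + T1 alpha phi0 - T1 alpha phi1.

Definition T_Cl (phi0 phi1 : R) (k : nat) (alpha : R) : R :=
  (4 * INR k + 2) * T alpha - T1 alpha phi0 + T1 alpha phi1.

Definition T_D (phi0 phi1 : R) (k : nat) (alpha : R) : R :=
  4 * (INR k + 1) * T alpha - T1 alpha phi0 - T1 alpha phi1.

Definition convex_on (a b : R) (f : R -> R) : Prop :=
  forall x y t, a < x < b -> a < y < b -> 0 <= t <= 1 ->
    f (t * x + (1 - t) * y) <= t * f x + (1 - t) * f y.

Definition local_min (f : R -> R) (x0 : R) : Prop :=
  locally x0 (fun x => f x0 <= f x).

Definition local_max (f : R -> R) (x0 : R) : Prop :=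
  locally x0 (fun x => f x <= f x0).

Definition bvp_solution (phi0 phi1 L : R) (x y : R -> R) : Prop :=
  continuous_on (fun t => - L <= t <= L) x /\
  continuous_on (fun t => - L <= t <= L) y /\
  (forall t, - L < t < L ->
     is_derive x t (y t) /\ is_derive y t (- sin (2 * x t))) /\
  x (- L) = - phi0 /\ x L = phi1.

(* [theta] is a continuous determination of the polar angle of [(x, y)] along
   [[a, b]]. Since [x' = y], orbits turn clockwise around the origin, so the
   angle swept is [theta a - theta b]; it amounts to [k] full turns and an
   incomplete one. *)
Definition full_turns (k : nat) (a b : R) (x y : R -> R) : Prop :=
  exists theta : R -> R,
    continuous_on (fun t => a <= t <= b) theta /\
    (forall t, a <= t <= b ->
       x t = sqrt (x t ^ 2 + y t ^ 2) * cos (theta t) /\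
       y t = sqrt (x t ^ 2 + y t ^ 2) * sin (theta t)) /\
    INR k * (2 * PI) <= theta a - theta b < (INR k + 1) * (2 * PI).

Definition type_A_orbit (phi0 phi1 : R) (k : nat) (alpha L : R) (x y : R -> R)
  : Prop :=
  bvp_solution phi0 phi1 L x y /\
  (forall t, - L <= t <= L -> y t ^ 2 - cos (2 * x t) = - cos (2 * alpha)) /\
  0 < y (- L) /\ 0 < y L /\
  full_turns k (- L) L x y.

(* Points of the diagram are pairs [(L, y (- L))]. *)
Definition type_A_branch (phi0 phi1 : R) (k : nat) (p : R * R) : Prop :=
  exists (alpha : R) (x y : R -> R),
    phi1 < alpha < PI / 2 /\ 0 < fst p /\
    type_A_orbit phi0 phi1 k alpha (fst p) x y /\
    snd p = y (- fst p).

(* The branch is a curve on which [L] is a convex function of [y (- L)]. *)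
Definition convex_branch (B : R * R -> Prop) : Prop :=
  exists (a b : R) (ell : R -> R),
    a < b /\ convex_on a b ell /\
    forall L y, B (L, y) <-> a < y < b /\ L = ell y.

(* Following the branch by increasing [y (- L)], the parameter [L] strictly
   decreases up to [p] and strictly increases after it, or conversely. *)
Definition saddle_node (B : R * R -> Prop) (p : R * R) : Prop :=
  B p /\
  exists eps : R, 0 < eps /\
    let before q r := snd p - eps < snd q /\ snd q < snd r /\ snd r <= snd p in
    let after q r := snd p <= snd q /\ snd q < snd r /\ snd r < snd p + eps in
    (forall q r, B q -> B r ->
       (before q r -> fst r < fst q) /\ (after q r -> fst q < fst r)) \/
    (forall q r, B q -> B r ->
       (before q r -> fst q < fst r) /\ (after q r -> fst r < fst q)).

(* Main.v *)
Require Import Defs.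
From Stdlib Require Import Reals ZArith Lra Lia Psatz.
From Coquelicot Require Import Coquelicot.
Open Scope R_scope.

(** Put [s = sin^2 alpha]. Up to the factor [1 / sqrt 2], [T alpha] is the complete
    elliptic integral [legendreK s] and [T1 alpha phi] is the integral
    [transit s 0 phi] of [(s - sin^2 x)^(-1/2)]; the two are linked by the
    substitution [sin x = sqrt s * sin theta] ([transit_legendreF]). The complete
    integral increases with [s], a transit between two fixed abscissae decreases
    with [s], and both are strictly convex because [u^(-1/2)] is. This gives (a),
    (b) and (c) at once, and makes [T_Cl] and [T_A] strictly convex in [s], since
    [T_Cl] involves the two partial transits only through the transit from [phi0]
    to [phi1].

    Both functions tend to infinity at [s = 1] together with the complete integral.
    At the other end, [s1 = sin^2 phi1], the transit up to [phi1] lies below the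
    complete integral by at least [sqrt (s - s1)] ([transit_le_legendreK_sqrt]),
    while all other terms are Lipschitz there, so that [T_Cl] and [T_A] dip below
    their limits ([time_sum_dip]). A strictly convex function that descends
    somewhere and blows up at the right end has the shape of a valley
    ([strict_convex_valley]); hence the unique extremum of [T_Cl] and, as the initial
    speed is an increasing function of [s], the unique saddle-node.

    On an orbit of energy [s], the point [(sin x, y / sqrt 2)] moves on the circle of
    radius [sqrt s]. Its angle has velocity [- sqrt 2 * cos x], so the elapsed time
    is an increment of [legendreF s] along that angle ([pendulum_arc_time]), and the
    inverse function of [legendreF s] produces the orbits. The angle in question and
    the polar angle of [(x, y)] stay less than a quarter turn apart, and count the same
    turns. So the branch is the graph of [half_time] over the interval of initial
    speeds ([type_A_branch_graph]).

    Convexity of [half_time] is more delicate than convexity in [s]: with the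
    speed written as [sqrt 2 * w], so that [s = sin^2 phi0 + w^2], the transit up
    to [phi0] need not be a convex function of [w]. Its second derivative is at
    least [- 2] times the integral of [sin^2 theta / (1 - s sin^2 theta)^(3/2)]
    ([RInt_bend_lower]), an integral which the second derivative of the complete
    integral dominates. At least [4] complete integrals enter [T_A] because [k >= 1],
    and they compensate the two partial transits ([total_time_convex_in_speed]). *)

(** * Strictly convex functions and valleys *)

Definition strict_convex_on (a b : R) (f : R -> R) : Prop :=
  forall x y t, a < x -> x < y -> y < b -> 0 < t < 1 ->
    f (t * x + (1 - t) * y) < t * f x + (1 - t) * f y.

(** The shape of a strictly convex function with an interior minimum at [c]. *)
Definition valley (a b : R) (f : R -> R) (c : R) : Prop :=
  a < c < b /\
  (forall x y, a < x -> x < y -> y <= c -> f y < f x) /\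
  (forall x y, c <= x -> x < y -> y < b -> f x < f y).

Lemma strict_convex_on_convex_on a b f :
  strict_convex_on a b f -> convex_on a b f.
Proof.
  intros H x y t Hx Hy Ht.
  destruct (Req_dec t 0) as [->|H0].
  { replace (0 * x + (1 - 0) * y) with y by ring. lra. }
  destruct (Req_dec t 1) as [->|H1].
  { replace (1 * x + (1 - 1) * y) with x by ring. lra. }
  destruct (Rtotal_order x y) as [L|[->|L]].
  - apply Rlt_le, H; lra.
  - replace (t * y + (1 - t) * y) with y by ring. lra.
  - replace (t * x + (1 - t) * y) with ((1 - t) * y + (1 - (1 - t)) * x) by ring.
    replace (t * f x + (1 - t) * f y)
      with ((1 - t) * f y + (1 - (1 - t)) * f x) by ring.
    apply Rlt_le, H; lra.
Qed.

Lemma strict_convex_on_ext a b f g :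
  (forall x, a < x < b -> f x = g x) ->
  strict_convex_on a b f -> strict_convex_on a b g.
Proof.
  intros E H x y t Hx Hxy Hy Ht.
  rewrite <- !E; try (split; nra). now apply H.
Qed.

Lemma strict_convex_on_plus a b f g :
  strict_convex_on a b f -> strict_convex_on a b g ->
  strict_convex_on a b (fun x => f x + g x).
Proof.
  intros Hf Hg x y t Hx Hxy Hy Ht.
  specialize (Hf x y t Hx Hxy Hy Ht). specialize (Hg x y t Hx Hxy Hy Ht). lra.
Qed.

Lemma strict_convex_on_scal a b c f :
  0 < c -> strict_convex_on a b f -> strict_convex_on a b (fun x => c * f x).
Proof.
  intros Hc Hf x y t Hx Hxy Hy Ht.
  specialize (Hf x y t Hx Hxy Hy Ht).
  apply (Rmult_lt_compat_l c) in Hf; lra.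
Qed.

Lemma strict_convex_on_subset a b a' b' f :
  a <= a' -> b' <= b -> strict_convex_on a b f -> strict_convex_on a' b' f.
Proof. intros Ha Hb H x y t Hx Hxy Hy Ht; apply H; lra. Qed.

Lemma strict_convex_chord a b f x z y :
  strict_convex_on a b f -> a < x -> x < z -> z < y -> y < b ->
  (y - x) * f z < (y - z) * f x + (z - x) * f y.
Proof.
  intros H Hx Hz Hy Hb.
  set (t := (y - z) / (y - x)).
  assert (Et : t * (y - x) = y - z) by (unfold t; field; lra).
  assert (Ht : 0 < t < 1) by (split; nra).
  assert (E : t * x + (1 - t) * y = z) by nra.
  assert (Hxy : x < y) by lra.
  specialize (H x y t Hx Hxy Hb Ht). rewrite E in H.
  apply (Rmult_lt_compat_l (y - x)) in H; [|lra].
  replace (z - x) with ((1 - t) * (y - x)) by nra.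
  rewrite <- Et. lra.
Qed.

Lemma strict_convex_lt_max a b f x z y :
  strict_convex_on a b f -> a < x -> x < z -> z < y -> y < b ->
  f z < f x \/ f z < f y.
Proof.
  intros H Hx Hz Hy Hb.
  pose proof (strict_convex_chord a b f x z y H Hx Hz Hy Hb).
  destruct (Rlt_le_dec (f z) (f x)); [now left|right; nra].
Qed.

Lemma strict_convex_continuity_pt a b f x :
  strict_convex_on a b f -> a < x < b -> continuity_pt f x.
Proof.
  intros H Hx.
  set (d := Rmin (x - a) (b - x) / 2).
  assert (Hd : 0 < d /\ a < x - d /\ x + d < b).
  { unfold d. pose proof (Rmin_l (x - a) (b - x)).
    pose proof (Rmin_r (x - a) (b - x)).
    assert (0 < Rmin (x - a) (b - x)) by (apply Rmin_glb_lt; lra). lra. }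
  destruct Hd as [Hd [Ha Hb]].
  set (M := Rabs (f (x - d) - f x) + Rabs (f (x + d) - f x) + 1).
  assert (HM : - M <= f (x - d) - f x <= M /\ - M <= f (x + d) - f x <= M /\ 0 < M).
  { unfold M. split_Rabs; lra. }
  destruct HM as [M1 [M2 M0]].
  (* the two chords through [x] squeeze the graph between lines of slope M/d *)
  assert (Q : forall h, Rabs h < d -> d * Rabs (f (x + h) - f x) <= Rabs h * M).
  { intros h Hh. destruct (Rtotal_order h 0) as [L|[->|L]].
    - rewrite (Rabs_left h) in * by lra.
      pose proof (strict_convex_chord a b f (x - d) (x + h) x H) as C1.
      pose proof (strict_convex_chord a b f (x + h) x (x + d) H) as C2.
      assert (C1' := C1 ltac:(lra) ltac:(lra) ltac:(lra) ltac:(lra)).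
      assert (C2' := C2 ltac:(lra) ltac:(lra) ltac:(lra) ltac:(lra)).
      clear C1 C2. unfold Rabs; destruct Rcase_abs; nra.
    - rewrite Rplus_0_r, Rminus_diag, Rabs_R0. lra.
    - rewrite (Rabs_right h) in * by lra.
      pose proof (strict_convex_chord a b f x (x + h) (x + d) H) as C1.
      pose proof (strict_convex_chord a b f (x - d) x (x + h) H) as C2.
      assert (C1' := C1 ltac:(lra) ltac:(lra) ltac:(lra) ltac:(lra)).
      assert (C2' := C2 ltac:(lra) ltac:(lra) ltac:(lra) ltac:(lra)).
      clear C1 C2. unfold Rabs; destruct Rcase_abs; nra. }
  intros eps Heps.
  exists (Rmin d (eps * d / (2 * M))).
  assert (Hq : 0 < eps * d / (2 * M)).
  { apply Rdiv_lt_0_compat; [apply Rmult_lt_0_compat; lra|lra]. }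
  split; [apply Rmin_glb_lt; lra|].
  intros y [_ Hy]. unfold dist in *; simpl in *; unfold Rdist in *.
  assert (H1 := Rlt_le_trans _ _ _ Hy (Rmin_l _ _)).
  assert (H2 := Rlt_le_trans _ _ _ Hy (Rmin_r _ _)).
  specialize (Q (y - x) H1). replace (x + (y - x)) with y in Q by ring.
  apply (Rmult_lt_compat_r (2 * M)) in H2; [|lra].
  replace (eps * d / (2 * M) * (2 * M)) with (eps * d) in H2 by (field; lra).
  apply (Rmult_lt_reg_l d); [lra|]. nra.
Qed.

(** A minimum on the compact interval bounded by [x1] and by a point where [f] exceeds
    [f x2] is interior to it, and by convexity it is a global one. *)
Lemma strict_convex_valley a b f x1 x2 :
  strict_convex_on a b f ->
  a < x1 -> x1 < x2 -> x2 < b -> f x2 < f x1 ->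
  (forall M, exists e, a < e < b /\ forall s, e < s < b -> M < f s) ->
  exists c, valley a b f c.
Proof.
  intros H H1 H12 H2 Hf Hinf.
  destruct (Hinf (f x2)) as [e [He Hs]].
  set (x3 := (Rmax e x2 + b) / 2).
  assert (H3 : e < x3 < b /\ x2 < x3).
  { unfold x3. pose proof (Rmax_l e x2). pose proof (Rmax_r e x2).
    assert (Rmax e x2 < b) by (apply Rmax_lub_lt; lra). lra. }
  destruct H3 as [H3 H23].
  specialize (Hs x3 H3).
  destruct (continuity_ab_min f x1 x3) as [c [Hc Hcin]]; [lra| |].
  { intros z Hz. apply (strict_convex_continuity_pt a b); [easy|lra]. }
  assert (H2c := Hc x2 ltac:(lra)).
  assert (c <> x1) by (intros ->; lra).
  assert (c <> x3) by (intros ->; lra).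
  assert (G : forall z, a < z < b -> f c <= f z).
  { intros z Hz. destruct (Rle_lt_dec x1 z) as [L|L].
    - destruct (Rle_lt_dec z x3) as [L'|L']; [apply Hc; lra|].
      assert (Q := Hc x3 ltac:(lra)).
      destruct (strict_convex_lt_max a b f c x3 z H) as [Q'|Q']; lra.
    - assert (Q := Hc x1 ltac:(lra)).
      destruct (strict_convex_lt_max a b f z x1 c H) as [Q'|Q']; lra. }
  exists c. split; [lra|split].
  - intros x y Hx Hxy Hy.
    destruct (Req_dec y c) as [->|N].
    + assert (Q := G ((x + c) / 2) ltac:(lra)).
      destruct (strict_convex_lt_max a b f x ((x + c) / 2) c H); lra.
    + assert (Q := G y ltac:(lra)).
      destruct (strict_convex_lt_max a b f x y c H); lra.
  - intros x y Hx Hxy Hy.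
    destruct (Req_dec x c) as [->|N].
    + assert (Q := G ((c + y) / 2) ltac:(lra)).
      destruct (strict_convex_lt_max a b f c ((c + y) / 2) y H); lra.
    + assert (Q := G x ltac:(lra)).
      destruct (strict_convex_lt_max a b f c x y H); lra.
Qed.

Lemma valley_not_extremum a b f c x e :
  valley a b f c -> a < x < b -> x <> c -> 0 < e ->
  exists u v, Rabs (u - x) < e /\ Rabs (v - x) < e /\ f u < f x < f v.
Proof.
  intros [Hc [Hd Hi]] Hx N He.
  set (r := Rmin e (Rmin (Rabs (x - c)) (Rmin (x - a) (b - x)))).
  assert (Hr : 0 < r).
  { repeat apply Rmin_glb_lt; try lra. apply Rabs_pos_lt. lra. }
  assert (R1 : r <= e) by apply Rmin_l.
  assert (R2 : r <= Rmin (Rabs (x - c)) (Rmin (x - a) (b - x))) by apply Rmin_r.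
  pose proof (Rmin_l (Rabs (x - c)) (Rmin (x - a) (b - x))).
  pose proof (Rmin_r (Rabs (x - c)) (Rmin (x - a) (b - x))).
  pose proof (Rmin_l (x - a) (b - x)). pose proof (Rmin_r (x - a) (b - x)).
  assert (L : Rabs (x - r / 2 - x) < e /\ Rabs (x + r / 2 - x) < e)
    by (split_Rabs; lra).
  destruct (Rtotal_order x c) as [K|[E|K]]; [|contradiction|].
  - rewrite (Rabs_left (x - c)) in * by lra.
    exists (x + r / 2), (x - r / 2). split; [easy|split; [easy|]].
    split; apply Hd; lra.
  - rewrite (Rabs_pos_eq (x - c)) in * by lra.
    exists (x - r / 2), (x + r / 2). split; [easy|split; [easy|]].
    split; apply Hi; lra.
Qed.

Lemma valley_unique_extremum a b f c :
  valley a b f c ->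
  local_min f c /\
  forall x, a < x < b -> local_min f x \/ local_max f x -> x = c.
Proof.
  intros V. assert (V' := V). destruct V' as [Hc [Hd Hi]]. split.
  - assert (L : locally c (fun y => a < y /\ y < b)).
    { apply filter_and; [apply (open_gt a)|apply (open_lt b)]; lra. }
    unfold local_min. revert L. apply filter_imp. intros y Hy.
    destruct (Rtotal_order y c) as [K|[->|K]];
      [apply Rlt_le, Hd|apply Rle_refl|apply Rlt_le, Hi]; lra.
  - intros x Hx E. destruct (Req_dec x c) as [|N]; [easy|exfalso].
    destruct E as [[e E]|[e E]];
      destruct (valley_not_extremum a b f c x e V Hx N (cond_pos e))
        as [u [v [Hu [Hv Hf]]]].
    + specialize (E u Hu). lra.
    + specialize (E v Hv). lra.
Qed.

(** Increasing changes of variable and positive factors preserve valleys. *)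
Lemma valley_transport a b a' b' f g h r u c :
  valley a b f c -> 0 < r -> a' < u < b' -> g u = c ->
  (forall x, a' < x < b' -> a < g x < b) ->
  (forall x y, a' < x -> x < y -> y < b' -> g x < g y) ->
  (forall x, a' < x < b' -> h x = r * f (g x)) ->
  valley a' b' h u.
Proof.
  intros [Hc [Hd Hi]] Hr Hu E Hg Hm Hh. split; [easy|split].
  - intros x y Hx Hxy Hy. rewrite !Hh by lra. apply Rmult_lt_compat_l; [easy|].
    apply Hd; [apply Hg; lra|apply Hm; lra|].
    rewrite <- E. destruct Hy as [Hy| ->]; [apply Rlt_le, Hm; lra|lra].
  - intros x y Hx Hxy Hy. rewrite !Hh by lra. apply Rmult_lt_compat_l; [easy|].
    apply Hi; [|apply Hm; lra|apply Hg; lra].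
    rewrite <- E. destruct Hx as [Hx| <-]; [apply Rlt_le, Hm; lra|lra].
Qed.

(** A saddle-node of a graph is a point where the monotonicity changes, and on a valley
    this happens only at the bottom. *)
Lemma valley_saddle_node a b ell y0 (B : R * R -> Prop) :
  (forall L y, B (L, y) <-> a < y < b /\ L = ell y) ->
  valley a b ell y0 ->
  saddle_node B (ell y0, y0) /\
  (forall q, B q -> ell y0 <= fst q) /\
  (forall q, saddle_node B q -> q = (ell y0, y0)).
Proof.
  intros HB V. assert (V' := V). destruct V' as [Hy [Hd Hi]].
  split; [|split].
  - split; [apply HB; easy|].
    exists 1; split; [lra|]. left. intros [L1 z1] [L2 z2] B1 B2.
    apply HB in B1. apply HB in B2. destruct B1 as [B1 ->], B2 as [B2 ->].
    unfold fst, snd. split; intros P; [apply Hd|apply Hi]; lra.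
  - intros [L z] Q. apply HB in Q. destruct Q as [Q ->]. simpl.
    destruct (Rtotal_order z y0) as [K|[->|K]]; [|lra|].
    + apply Rlt_le, Hd; lra.
    + apply Rlt_le, Hi; lra.
  - intros [L z] [Q [e [He P]]]. apply HB in Q. destruct Q as [Q ->].
    simpl in P.
    assert (Hcase : (forall x y, a < x < b -> a < y < b ->
      z <= x /\ x < y /\ y < z + e -> ell x < ell y) \/
      (forall x y, a < x < b -> a < y < b ->
       z - e < x /\ x < y /\ y <= z -> ell x < ell y)).
    { destruct P as [P|P]; [left|right]; intros x y Hx Hy';
      apply (P (ell x, x) (ell y, y)); apply HB; easy. }
    assert (Hcase' : (forall x y, a < x < b -> a < y < b ->
      z - e < x /\ x < y /\ y <= z -> ell y < ell x) \/
      (forall x y, a < x < b -> a < y < b ->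
       z <= x /\ x < y /\ y < z + e -> ell y < ell x)).
    { destruct P as [P|P]; [left|right]; intros x y Hx Hy';
      apply (P (ell x, x) (ell y, y)); apply HB; easy. }
    clear P.
    assert (E : z = y0); [|now rewrite E].
    destruct (Rtotal_order z y0) as [K|[->|K]]; [exfalso|easy|exfalso].
    + set (h := Rmin e (Rmin (z - a) (y0 - z)) / 2).
      assert (Hh : 0 < h /\ h < e /\ h < z - a /\ h < y0 - z).
      { unfold h. pose proof (Rmin_l e (Rmin (z - a) (y0 - z))).
        pose proof (Rmin_r e (Rmin (z - a) (y0 - z))).
        pose proof (Rmin_l (z - a) (y0 - z)).
        pose proof (Rmin_r (z - a) (y0 - z)).
        assert (0 < Rmin e (Rmin (z - a) (y0 - z)))
          by (repeat apply Rmin_glb_lt; lra). lra. }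
      destruct Hcase as [P|P].
      * assert (A1 := P z (z + h)). assert (A2 := Hd z (z + h)). lra.
      * assert (A1 := P (z - h) z). assert (A2 := Hd (z - h) z). lra.
    + set (h := Rmin e (Rmin (b - z) (z - y0)) / 2).
      assert (Hh : 0 < h /\ h < e /\ h < b - z /\ h < z - y0).
      { unfold h. pose proof (Rmin_l e (Rmin (b - z) (z - y0))).
        pose proof (Rmin_r e (Rmin (b - z) (z - y0))).
        pose proof (Rmin_l (b - z) (z - y0)).
        pose proof (Rmin_r (b - z) (z - y0)).
        assert (0 < Rmin e (Rmin (b - z) (z - y0)))
          by (repeat apply Rmin_glb_lt; lra). lra. }
      destruct Hcase' as [P|P].
      * assert (A1 := P (z - h) z). assert (A2 := Hi (z - h) z). lra.
      * assert (A1 := P z (z + h)). assert (A2 := Hi z (z + h)). lra.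
Qed.

(** * Integrals of inverse square roots *)

(** Reads an equation in a normed module over the reals as one between real numbers,
    so that [ring] and [field] apply. *)
Ltac eq_in_R := match goal with |- @eq _ ?u ?v => change (@eq R u v) end.

Lemma continuous_inv_sqrt (f : R -> R) x :
  continuous f x -> 0 < f x -> continuous (fun x => / sqrt (f x)) x.
Proof.
  intros Hf Hp. apply (continuous_comp f (fun u => / sqrt u)); [easy|].
  apply (ex_derive_continuous (fun u => / sqrt u)). auto_derive.
  split; [easy|split; [|easy]]. now apply Rgt_not_eq, sqrt_lt_R0.
Qed.

(** The difference of the two sides is [(p - q)^2 (p + 2 q) / (2 q^3 p)], where
    [p = sqrt u] and [q = sqrt c]. *)
Lemma inv_sqrt_above_tangent u c :
  0 < u -> 0 < c -> u <> c ->
  / sqrt c - (u - c) / (2 * c * sqrt c) < / sqrt u.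
Proof.
  intros Hu Hc N.
  assert (Ha := sqrt_lt_R0 u Hu). assert (Hd := sqrt_lt_R0 c Hc).
  assert (Ea := sqrt_sqrt u ltac:(lra)). assert (Ed := sqrt_sqrt c ltac:(lra)).
  set (p := sqrt u) in *. set (q := sqrt c) in *.
  assert (p <> q) by (intros E; apply N; rewrite <- Ea, <- Ed, E; easy).
  rewrite <- Ea, <- Ed.
  apply Rlt_0_minus.
  replace (/ p - (/ q - (p * p - q * q) / (2 * (q * q) * q)))
    with ((p - q) ^ 2 * (p + 2 * q) / (2 * q ^ 3 * p)) by (field; lra).
  apply Rdiv_lt_0_compat.
  - apply Rmult_lt_0_compat; [|lra]. apply pow2_gt_0. lra.
  - apply Rmult_lt_0_compat; [|lra]. assert (0 < q ^ 3) by now apply pow_lt. lra.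
Qed.

Lemma inv_sqrt_strict_convex u v t :
  0 < u -> 0 < v -> u <> v -> 0 < t < 1 ->
  / sqrt (t * u + (1 - t) * v) < t * / sqrt u + (1 - t) * / sqrt v.
Proof.
  intros Hu Hv N Ht. set (c := t * u + (1 - t) * v).
  assert (Hc : 0 < c) by (unfold c; nra).
  assert (Tu : u <> c) by (unfold c; intros E; apply N; nra).
  assert (Tv : v <> c) by (unfold c; intros E; apply N; nra).
  assert (Q1 := inv_sqrt_above_tangent u c Hu Hc Tu).
  assert (Q2 := inv_sqrt_above_tangent v c Hv Hc Tv).
  set (K := / sqrt c) in *.
  assert (E : t * ((u - c) / (2 * c * sqrt c))
            + (1 - t) * ((v - c) / (2 * c * sqrt c)) = 0).
  { unfold c. field. fold c. split; [|lra]. now apply Rgt_not_eq, sqrt_lt_R0. }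
  nra.
Qed.

Lemma RInt_inv_sqrt_strict_convex (A B : R -> R) a b lo hi :
  a < b -> (forall x, continuous A x) -> (forall x, continuous B x) ->
  (forall s x, lo < s < hi -> a <= x <= b -> 0 < A x + B x * s) ->
  (forall x, a < x < b -> B x <> 0) ->
  strict_convex_on lo hi
    (fun s => RInt (fun x => / sqrt (A x + B x * s)) a b).
Proof.
  intros Hab HA HB HD HN s1 s2 t Hs1 Hs12 Hs2 Ht.
  assert (C : forall s x, lo < s < hi -> a <= x <= b ->
            continuous (fun x => / sqrt (A x + B x * s)) x).
  { intros s x Hs Hx. apply continuous_inv_sqrt; [|now apply HD].
    apply (continuous_plus A (fun x => B x * s)); [easy|].
    apply (continuous_mult B (fun _ => s)); [easy|apply continuous_const]. }
  assert (I : forall s, lo < s < hi -> ex_RInt (fun x => / sqrt (A x + B x * s)) a b).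
  { intros s Hs. apply (ex_RInt_continuous (V := R_CompleteNormedModule)).
    rewrite Rmin_left, Rmax_right by lra. intros x Hx; now apply C. }
  assert (Hs : lo < t * s1 + (1 - t) * s2 < hi) by (split; nra).
  rewrite <- (RInt_scal (V := R_CompleteNormedModule) _ a b t) by (apply I; lra).
  rewrite <- (RInt_scal (V := R_CompleteNormedModule) _ a b (1 - t)) by (apply I; lra).
  rewrite <- (RInt_plus (V := R_CompleteNormedModule)).
  2, 3: apply (ex_RInt_scal (V := R_CompleteNormedModule)); apply I; lra.
  apply RInt_lt; [easy| | |].
  - intros x Hx.
    apply (continuous_plus (V := R_NormedModule)
      (fun x => t * / sqrt (A x + B x * s1))
      (fun x => (1 - t) * / sqrt (A x + B x * s2)));
    apply (continuous_scal_r (V := R_NormedModule)); apply C; lra.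
  - intros x Hx. now apply C.
  - intros x Hx. unfold plus, scal, mult; simpl; unfold mult; simpl.
    replace (A x + B x * (t * s1 + (1 - t) * s2))
      with (t * (A x + B x * s1) + (1 - t) * (A x + B x * s2)) by ring.
    apply inv_sqrt_strict_convex; try (apply HD; lra); [|easy].
    intros E. assert (B x * (s1 - s2) = 0) by lra.
    apply (Rmult_integral_contrapositive_currified (B x) (s1 - s2));
    [now apply HN|lra|easy].
Qed.

(** Differentiation under the integral sign, with the hypotheses in a form that the
    derivative satisfies again when one differentiates twice. *)
Lemma is_derive_under_RInt (f f1 : R -> R -> R) a b lo hi :
  a <= b ->
  (forall w x, lo < w < hi -> a <= x <= b ->
     continuity_2d_pt f w x /\ continuity_2d_pt f1 w x /\
     locally_2d (fun u v => is_derive (fun z => f z v) u (f1 u v)) w x) ->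
  forall w, lo < w < hi ->
    is_derive (fun w => RInt (f w) a b) w (RInt (f1 w) a b).
Proof.
  intros Hab H w Hw.
  assert (Hloc : locally w (fun u => lo < u < hi)).
  { apply (open_and (fun u => lo < u) (fun u => u < hi));
    [apply open_gt|apply open_lt|easy]. }
  replace (RInt (f1 w) a b) with (RInt (fun x => Derive (fun u => f u x) w) a b).
  - apply (is_derive_RInt_param f a b w).
    + apply (filter_imp (fun u => lo < u < hi)); [|easy].
      intros u Hu x Hx. rewrite Rmin_left, Rmax_right in Hx by lra.
      exists (f1 u x). destruct (H u x Hu Hx) as [_ [_ L]].
      exact (locally_2d_singleton _ _ _ L).
    + intros x Hx. rewrite Rmin_left, Rmax_right in Hx by lra.
      destruct (H w x Hw Hx) as [_ [C L]].
      apply (continuity_2d_pt_ext_loc f1); [|easy].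
      revert L. apply locally_2d_impl, locally_2d_forall.
      intros u v Q. symmetry. now apply is_derive_unique.
    + apply (filter_imp (fun u => lo < u < hi)); [|easy].
      intros u Hu. apply (ex_RInt_continuous (V := R_CompleteNormedModule)).
      rewrite Rmin_left, Rmax_right by lra. intros x Hx.
      destruct (H u x Hu Hx) as [C _].
      apply continuity_2d_pt_filterlim in C.
      apply (filterlim_comp _ _ _ (fun x => (u, x)) (fun z => f (fst z) (snd z)) _
        (locally (u, x))); [|exact C].
      intros P [e He]. exists e. intros y Hy. apply He. split; [apply ball_center|easy].
  - apply RInt_ext. intros x Hx. rewrite Rmin_left, Rmax_right in Hx by lra.
    apply is_derive_unique. destruct (H w x Hw ltac:(lra)) as [_ [_ L]].
    exact (locally_2d_singleton _ _ _ L).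
Qed.

Lemma continuity_2d_pt_snd (A : R -> R) w x :
  continuous A x -> continuity_2d_pt (fun _ v => A v) w x.
Proof.
  intros HA.
  apply (continuity_1d_2d_pt_comp A (fun _ v => v)).
  - now apply continuity_pt_filterlim.
  - apply continuity_2d_pt_id2.
Qed.

(** Applies both to the complete integral ([B = - sin^2]) and to the transits ([B = 1]),
    whose radicands are affine in [w^2] when [s] is. *)
Lemma RInt_inv_sqrt_quadratic_derive (A B : R -> R) a b lo hi :
  a <= b -> (forall x, continuous A x) -> (forall x, continuous B x) ->
  (forall w x, lo < w < hi -> a <= x <= b -> 0 < A x + B x * w ^ 2) ->
  forall w, lo < w < hi ->
  is_derive (fun w => RInt (fun x => / sqrt (A x + B x * w ^ 2)) a b) w
    (RInt (fun x => - (B x * w) * / sqrt (A x + B x * w ^ 2) ^ 3) a b) /\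
  is_derive
    (fun w => RInt (fun x => - (B x * w) * / sqrt (A x + B x * w ^ 2) ^ 3) a b) w
    (RInt (fun x => - B x * / sqrt (A x + B x * w ^ 2) ^ 3 +
       3 * (B x * w) ^ 2 * / sqrt (A x + B x * w ^ 2) ^ 5) a b).
Proof.
  intros Hab HA HB HD.
  set (D := fun w x => A x + B x * w ^ 2).
  assert (CD : forall w x, continuity_2d_pt D w x).
  { intros w x. apply continuity_2d_pt_plus; [now apply continuity_2d_pt_snd|].
    apply continuity_2d_pt_mult; [now apply continuity_2d_pt_snd|].
    simpl. apply continuity_2d_pt_mult; [apply continuity_2d_pt_id1|].
    apply continuity_2d_pt_mult; [apply continuity_2d_pt_id1|].
    apply continuity_2d_pt_const. }
  assert (CS : forall n w x, 0 < D w x ->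
             continuity_2d_pt (fun u v => / sqrt (D u v) ^ n) w x).
  { intros n w x HDw.
    apply (continuity_1d_2d_pt_comp (fun d => / sqrt d ^ n) D); [|apply CD].
    apply continuity_pt_filterlim.
    apply (ex_derive_continuous (fun d => / sqrt d ^ n)). auto_derive.
    split; [easy|split; [|easy]]. now apply pow_nonzero, Rgt_not_eq, sqrt_lt_R0. }
  assert (CB : forall w x, continuity_2d_pt (fun u v => B v * u) w x).
  { intros w x. apply continuity_2d_pt_mult; [now apply continuity_2d_pt_snd|].
    apply continuity_2d_pt_id1. }
  assert (LD : forall w x, lo < w < hi -> a <= x <= b ->
             locally_2d (fun u v => 0 < D u v) w x).
  { intros w x Hw Hx. specialize (HD w x Hw Hx). fold (D w x) in HD.
    destruct (CD w x (mkposreal _ HD)) as [d Hd]. exists d.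
    intros u v Hu Hv. specialize (Hd u v Hu Hv). simpl in Hd. split_Rabs; lra. }
  intros w Hw. split.
  - apply (is_derive_under_RInt (fun w x => / sqrt (D w x))
      (fun w x => - (B x * w) * / sqrt (D w x) ^ 3) a b lo hi); [easy| |easy].
    clear w Hw. intros w x Hw Hx. assert (P := HD w x Hw Hx). fold (D w x) in P.
    split; [|split].
    + apply (continuity_2d_pt_ext (fun u v => / sqrt (D u v) ^ 1)); [|now apply CS].
      intros u v. now rewrite pow_1.
    + apply continuity_2d_pt_mult; [|now apply CS].
      apply continuity_2d_pt_opp, CB.
    + generalize (LD w x Hw Hx). apply locally_2d_impl, locally_2d_forall.
      intros u v Q. unfold D in *.
      assert (S := sqrt_lt_R0 _ Q). assert (E := sqrt_sqrt _ (Rlt_le _ _ Q)).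
      auto_derive.
      * repeat split; change (u * (u * 1)) with (u ^ 2); lra.
      * change (u * (u * 1)) with (u ^ 2). field. lra.
  - apply (is_derive_under_RInt (fun w x => - (B x * w) * / sqrt (D w x) ^ 3)
      (fun w x => - B x * / sqrt (D w x) ^ 3 +
         3 * (B x * w) ^ 2 * / sqrt (D w x) ^ 5) a b lo hi); [easy| |easy].
    clear w Hw. intros w x Hw Hx. assert (P := HD w x Hw Hx). fold (D w x) in P.
    split; [|split].
    + apply continuity_2d_pt_mult; [|now apply CS].
      apply continuity_2d_pt_opp, CB.
    + apply continuity_2d_pt_plus; (apply continuity_2d_pt_mult; [|now apply CS]).
      * apply continuity_2d_pt_opp. now apply continuity_2d_pt_snd.
      * apply continuity_2d_pt_mult; [apply continuity_2d_pt_const|].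
        simpl. repeat apply continuity_2d_pt_mult; try now apply continuity_2d_pt_snd.
        all: try apply continuity_2d_pt_id1. apply continuity_2d_pt_const.
    + generalize (LD w x Hw Hx). apply locally_2d_impl, locally_2d_forall.
      intros u v Q. unfold D in *.
      assert (S := sqrt_lt_R0 _ Q). assert (E := sqrt_sqrt _ (Rlt_le _ _ Q)).
      auto_derive.
      * change (u * (u * 1)) with (u ^ 2). repeat split; try lra.
        apply Rgt_not_eq. nra.
      * change (u * (u * 1)) with (u ^ 2). field. lra.
Qed.

Lemma convex_on_derive2 (f f1 f2 : R -> R) a b :
  (forall x, a < x < b -> is_derive f x (f1 x)) ->
  (forall x, a < x < b -> is_derive f1 x (f2 x)) ->
  (forall x, a < x < b -> 0 <= f2 x) -> convex_on a b f.
Proof.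
  intros H1 H2 Hp.
  assert (M : forall x y, a < x -> x <= y -> y < b -> f1 x <= f1 y).
  { intros x y Hx Hxy Hy.
    destruct (MVT_gen f1 x y f2) as [c [Hc E]];
    rewrite ?Rmin_left, ?Rmax_right in * by lra.
    - intros z Hz. apply H2; lra.
    - intros z Hz. apply continuity_pt_filterlim, (ex_derive_continuous f1).
      eexists. apply H2; lra.
    - assert (0 <= f2 c) by (apply Hp; lra). nra. }
  assert (Tg : forall c x, a < c < b -> a < x < b -> f c + f1 c * (x - c) <= f x).
  { intros c x Hc Hx.
    destruct (MVT_gen f c x f1) as [d [Hd E]].
    - intros z [Hz1 Hz2]. apply H1. split.
      + apply Rlt_trans with (2 := Hz1). now apply Rmin_glb_lt.
      + apply Rlt_trans with (1 := Hz2). now apply Rmax_lub_lt.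
    - intros z [Hz1 Hz2]. apply continuity_pt_filterlim, (ex_derive_continuous f).
      eexists. apply H1. split.
      + apply Rlt_le_trans with (2 := Hz1). now apply Rmin_glb_lt.
      + apply Rle_lt_trans with (1 := Hz2). now apply Rmax_lub_lt.
    - destruct (Rle_lt_dec c x) as [L|L].
      + rewrite Rmin_left, Rmax_right in Hd by lra.
        assert (f1 c <= f1 d) by (apply M; lra). nra.
      + rewrite Rmin_right, Rmax_left in Hd by lra.
        assert (f1 d <= f1 c) by (apply M; lra). nra. }
  intros x y t Hx Hy Ht.
  set (c := t * x + (1 - t) * y).
  assert (Hc : a < c < b) by (unfold c; destruct (Req_dec t 0) as [->|]; split; nra).
  assert (Q1 := Tg c x Hc Hx). assert (Q2 := Tg c y Hc Hy).
  assert (E : t * (f1 c * (x - c)) + (1 - t) * (f1 c * (y - c)) = 0)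
    by (unfold c; ring).
  nra.
Qed.

(** * Elliptic integrals *)

(** Legendre's incomplete integral of the first kind, of parameter [s] (the square of the
    modulus). *)
Definition legendreF (s z : R) : R := RInt (fun th => / sqrt (1 - s * sin th ^ 2)) 0 z.
Definition legendreK (s : R) : R := legendreF s (PI / 2).
(** Up to the factor [1 / sqrt 2], the time that the orbit of energy [s] takes to go from
    abscissa [a] to abscissa [b]. *)
Definition transit (s a b : R) : R := RInt (fun x => / sqrt (s - sin x ^ 2)) a b.

Lemma sin2_bounds x : 0 <= sin x ^ 2 <= 1.
Proof. pose proof (SIN_bound x). split; nra. Qed.

Lemma sin_pos_quarter x : 0 < x < PI / 2 -> 0 < sin x < 1.
Proof.
  intros Hx. split; [apply sin_gt_0; lra|].
  rewrite <- sin_PI2. apply sin_increasing_1; lra.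
Qed.

Lemma sin2_lt x y : 0 <= x -> x < y -> y <= PI / 2 -> sin x ^ 2 < sin y ^ 2.
Proof.
  intros Hx Hxy Hy.
  assert (sin x < sin y) by (apply sin_increasing_1; lra).
  assert (0 <= sin x) by (apply sin_ge_0; lra). nra.
Qed.

Lemma sin2_le x y : 0 <= x -> x <= y -> y <= PI / 2 -> sin x ^ 2 <= sin y ^ 2.
Proof.
  intros Hx [Hxy| ->] Hy; [now apply Rlt_le, sin2_lt|lra].
Qed.

Lemma continuous_sin2 x : continuous (fun x => sin x ^ 2) x.
Proof. apply (ex_derive_continuous (fun x => sin x ^ 2)). now auto_derive. Qed.

Lemma legendreF_radicand_pos s z : 0 <= s < 1 -> 0 < 1 - s * sin z ^ 2.
Proof. intros Hs. pose proof (sin2_bounds z). nra. Qed.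

Lemma legendreF_integrand_continuous s z :
  0 <= s < 1 -> continuous (fun th => / sqrt (1 - s * sin th ^ 2)) z.
Proof.
  intros Hs. apply continuous_inv_sqrt; [|now apply legendreF_radicand_pos].
  apply (ex_derive_continuous (fun th => 1 - s * sin th ^ 2)). now auto_derive.
Qed.

Lemma legendreF_ex_RInt s a b :
  0 <= s < 1 -> ex_RInt (fun th => / sqrt (1 - s * sin th ^ 2)) a b.
Proof.
  intros Hs. apply (ex_RInt_continuous (V := R_CompleteNormedModule)).
  intros z _. now apply legendreF_integrand_continuous.
Qed.

Lemma legendreF_derive s z :
  0 <= s < 1 -> is_derive (legendreF s) z (/ sqrt (1 - s * sin z ^ 2)).
Proof.
  intros Hs. apply (is_derive_RInt (fun th => / sqrt (1 - s * sin th ^ 2)) _ 0).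
  - apply filter_forall. intros y. apply (RInt_correct (V := R_CompleteNormedModule)).
    now apply legendreF_ex_RInt.
  - now apply legendreF_integrand_continuous.
Qed.

Lemma legendreF_integrand_ge_1 s z : 0 <= s < 1 -> 1 <= / sqrt (1 - s * sin z ^ 2).
Proof.
  intros Hs. pose proof (legendreF_radicand_pos s z Hs). pose proof (sin2_bounds z).
  rewrite <- Rinv_1 at 1. apply Rinv_le_contravar; [now apply sqrt_lt_R0|].
  apply Rle_trans with (sqrt 1); [|rewrite sqrt_1; lra].
  apply sqrt_le_1_alt. nra.
Qed.

Lemma legendreF_expanding s a b :
  0 <= s < 1 -> a <= b -> b - a <= legendreF s b - legendreF s a.
Proof.
  intros Hs Hab.
  destruct (MVT_gen (legendreF s) a b (fun z => / sqrt (1 - s * sin z ^ 2)))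
    as [c [_ E]].
  - intros z _. now apply legendreF_derive.
  - intros z _. apply continuity_pt_filterlim, (ex_derive_continuous (legendreF s)).
    eexists. now apply legendreF_derive.
  - pose proof (legendreF_integrand_ge_1 s c Hs). nra.
Qed.

Lemma legendreF_lt s a b : 0 <= s < 1 -> a < b -> legendreF s a < legendreF s b.
Proof. intros Hs Hab. pose proof (legendreF_expanding s a b Hs ltac:(lra)). lra. Qed.

Lemma transit_radicand_pos s b x :
  0 <= x <= b -> b < PI / 2 -> sin b ^ 2 < s -> 0 < s - sin x ^ 2.
Proof. intros Hx Hb Hs. pose proof (sin2_le x b). lra. Qed.

Lemma transit_integrand_continuous s x :
  0 < s - sin x ^ 2 -> continuous (fun x => / sqrt (s - sin x ^ 2)) x.
Proof.
  intros Hs. apply continuous_inv_sqrt; [|easy].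
  apply (ex_derive_continuous (fun x => s - sin x ^ 2)). now auto_derive.
Qed.

Lemma transit_ex_RInt s a b :
  0 <= a <= b -> b < PI / 2 -> sin b ^ 2 < s ->
  ex_RInt (fun x => / sqrt (s - sin x ^ 2)) a b.
Proof.
  intros Ha Hb Hs. apply (ex_RInt_continuous (V := R_CompleteNormedModule)).
  rewrite Rmin_left, Rmax_right by lra. intros z Hz.
  apply transit_integrand_continuous, (transit_radicand_pos s b); lra.
Qed.

Lemma transit_Chasles s a b :
  0 <= a <= b -> b < PI / 2 -> sin b ^ 2 < s ->
  transit s 0 a + transit s a b = transit s 0 b.
Proof.
  intros Ha Hb Hs.
  apply (RInt_Chasles (V := R_CompleteNormedModule)); apply transit_ex_RInt; try lra.
  pose proof (sin2_le a b). lra.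
Qed.

Lemma transit_pos s a b :
  0 <= a < b -> b < PI / 2 -> sin b ^ 2 < s -> 0 < transit s a b.
Proof.
  intros Ha Hb Hs. apply RInt_gt_0; [lra| |].
  - intros x Hx. apply Rinv_0_lt_compat, sqrt_lt_R0, (transit_radicand_pos s b); lra.
  - intros x Hx. apply transit_integrand_continuous, (transit_radicand_pos s b); lra.
Qed.

Lemma transit_lt s s' a b :
  0 <= a < b -> b < PI / 2 -> sin b ^ 2 < s -> s < s' -> transit s' a b < transit s a b.
Proof.
  intros Ha Hb Hs Hss. apply RInt_lt; [lra| | |]; intros x Hx.
  - apply transit_integrand_continuous, (transit_radicand_pos s b); lra.
  - apply transit_integrand_continuous, (transit_radicand_pos s' b); lra.
  - assert (0 < s - sin x ^ 2) by (apply (transit_radicand_pos s b); lra).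
    apply Rinv_lt_contravar.
    + apply Rmult_lt_0_compat; apply sqrt_lt_R0; lra.
    + apply sqrt_lt_1; lra.
Qed.

Lemma legendreK_lt s s' : 0 <= s -> s < s' -> s' < 1 -> legendreK s < legendreK s'.
Proof.
  intros Hs Hss Hs'. assert (P := PI_RGT_0).
  apply RInt_lt; [lra| | |]; intros x Hx.
  - apply legendreF_integrand_continuous; lra.
  - apply legendreF_integrand_continuous; lra.
  - assert (Q := legendreF_radicand_pos s x ltac:(lra)).
    assert (Q' := legendreF_radicand_pos s' x ltac:(lra)).
    apply Rinv_lt_contravar.
    + apply Rmult_lt_0_compat; apply sqrt_lt_R0; lra.
    + apply sqrt_lt_1; try lra.
      assert (H := sin_pos_quarter x Hx).
      assert (0 < sin x ^ 2) by (apply pow_lt; lra). nra.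
Qed.

Lemma legendreK_pos s : 0 <= s < 1 -> 0 < legendreK s.
Proof.
  intros Hs. assert (P := PI_RGT_0).
  pose proof (legendreF_expanding s 0 (PI / 2) Hs ltac:(lra)).
  unfold legendreK. replace (legendreF s 0) with 0 in H; [lra|].
  unfold legendreF. symmetry. apply (RInt_point (V := R_CompleteNormedModule)).
Qed.

Lemma legendreK_strict_convex : strict_convex_on 0 1 legendreK.
Proof.
  apply (strict_convex_on_ext 0 1
    (fun s => RInt (fun th => / sqrt (1 + (- sin th ^ 2) * s)) 0 (PI / 2))).
  - intros s Hs. apply RInt_ext. intros x _. f_equal; f_equal; ring.
  - assert (P := PI_RGT_0). apply RInt_inv_sqrt_strict_convex; [lra| | | |].
    + intros x. apply continuous_const.
    + intros x. apply (continuous_opp (V := R_NormedModule)), continuous_sin2.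
    + intros s x Hs Hx. pose proof (legendreF_radicand_pos s x ltac:(lra)). lra.
    + intros x Hx. pose proof (sin_pos_quarter x Hx).
      assert (0 < sin x ^ 2) by (apply pow_lt; lra). lra.
Qed.

Lemma transit_strict_convex a b :
  0 <= a < b -> b < PI / 2 -> strict_convex_on (sin b ^ 2) 1 (fun s => transit s a b).
Proof.
  intros Ha Hb.
  apply (strict_convex_on_ext _ _
    (fun s => RInt (fun x => / sqrt (- sin x ^ 2 + 1 * s)) a b)).
  - intros s Hs. apply RInt_ext. intros x _. f_equal; f_equal; ring.
  - apply RInt_inv_sqrt_strict_convex; [lra| | | |].
    + intros x. apply (continuous_opp (V := R_NormedModule)), continuous_sin2.
    + intros x. apply continuous_const.
    + intros s x Hs Hx. pose proof (transit_radicand_pos s b x). lra.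
    + intros x Hx. lra.
Qed.

Lemma asin_ratio_bounds s x : 0 < s -> 0 <= sin x -> sin x ^ 2 < s ->
  0 <= sin x / sqrt s < 1.
Proof.
  intros Hs H0 H. assert (S := sqrt_lt_R0 s Hs). split.
  - apply Rdiv_le_0_compat; lra.
  - apply Rlt_div_l; [easy|]. rewrite Rmult_1_l.
    apply Rsqr_incrst_0; try lra. rewrite Rsqr_sqrt by lra. unfold Rsqr. lra.
Qed.

Lemma asin_ratio_derive s x : 0 < s -> 0 <= sin x -> sin x ^ 2 < s ->
  is_derive (fun x => asin (sin x / sqrt s)) x (cos x / sqrt (s - sin x ^ 2)).
Proof.
  intros Hs H0 H. assert (Hu := asin_ratio_bounds s x Hs H0 H).
  assert (S := sqrt_lt_R0 s Hs).
  assert (S' := sqrt_lt_R0 (s - sin x ^ 2) ltac:(lra)).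
  replace (cos x / sqrt (s - sin x ^ 2))
    with (scal (cos x / sqrt s) (1 / sqrt (1 - (sin x / sqrt s)²))).
  - apply (is_derive_comp asin (fun x => sin x / sqrt s)).
    + assert (Hu' : -1 < sin x / sqrt s < 1) by lra.
      apply is_derive_Reals. rewrite <- (derive_pt_asin _ Hu').
      apply (derive_pt_eq_1 _ _ _ (derivable_pt_asin _ Hu')). reflexivity.
    + auto_derive; [easy|]. field. lra.
  - unfold scal; cbn -[pow]; unfold mult; cbn -[pow].
    replace (1 - (sin x / sqrt s)²) with ((s - sin x ^ 2) / s).
    + rewrite sqrt_div by lra. field. lra.
    + unfold Rsqr. replace (sin x / sqrt s * (sin x / sqrt s))
        with (sin x ^ 2 / (sqrt s * sqrt s)) by (field; lra).
      rewrite sqrt_sqrt by lra. field. lra.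
Qed.

(** The substitution [sin x = sqrt s * sin theta]. *)
Lemma RInt_sin_subst (h : R -> R) s b :
  (forall th, continuous h th) -> 0 <= b < PI / 2 -> sin b ^ 2 < s ->
  RInt (fun x => cos x / sqrt (s - sin x ^ 2) * h (asin (sin x / sqrt s))) 0 b
  = RInt h 0 (asin (sin b / sqrt s)).
Proof.
  intros Hh Hb Hs.
  assert (H0 : asin (sin 0 / sqrt s) = 0).
  { rewrite sin_0. unfold Rdiv. rewrite Rmult_0_l. apply asin_0. }
  rewrite <- H0 at 2.
  apply (RInt_comp (V := R_CompleteNormedModule) h
    (fun x => asin (sin x / sqrt s)) (fun x => cos x / sqrt (s - sin x ^ 2))).
  - intros x _. apply Hh.
  - rewrite Rmin_left, Rmax_right by lra. intros x Hx.
    assert (sin x ^ 2 <= sin b ^ 2) by (apply sin2_le; lra).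
    assert (0 <= sin x) by (apply sin_ge_0; lra).
    split.
    + apply asin_ratio_derive; nra.
    + apply (continuous_mult cos (fun x => / sqrt (s - sin x ^ 2))).
      * apply continuous_cos.
      * apply transit_integrand_continuous. lra.
Qed.

Lemma sin_asin_ratio s x : 0 < s -> 0 <= sin x -> sin x ^ 2 < s ->
  s * sin (asin (sin x / sqrt s)) ^ 2 = sin x ^ 2.
Proof.
  intros Hs H0 H. pose proof (asin_ratio_bounds s x Hs H0 H).
  rewrite sin_asin by lra. assert (S := sqrt_lt_R0 s Hs).
  replace ((sin x / sqrt s) ^ 2) with (sin x ^ 2 / (sqrt s * sqrt s)) by (field; lra).
  rewrite sqrt_sqrt by lra. field. lra.
Qed.

(** In the variable [theta], [s - sin^2 x] becomes [s cos^2 theta], and the factor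
    [sqrt s * cos theta] cancels against the Jacobian. *)
Lemma transit_legendreF s b :
  0 <= b < PI / 2 -> sin b ^ 2 < s < 1 ->
  transit s 0 b = legendreF s (asin (sin b / sqrt s)).
Proof.
  intros Hb Hs. pose proof (sin2_bounds b). unfold legendreF.
  rewrite <- RInt_sin_subst; [|intros th; apply legendreF_integrand_continuous; lra|lra|lra].
  apply RInt_ext. rewrite Rmin_left, Rmax_right by lra. intros x Hx.
  assert (sin x ^ 2 <= sin b ^ 2) by (apply sin2_le; lra).
  assert (0 <= sin x) by (apply sin_ge_0; lra).
  rewrite sin_asin_ratio by lra.
  assert (0 < cos x) by (apply cos_gt_0; lra).
  replace (1 - sin x ^ 2) with ((cos x)²).
  2:{ pose proof (sin2_cos2 x). unfold Rsqr in *. lra. }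
  rewrite sqrt_Rsqr by lra.
  eq_in_R.
  field. split; apply Rgt_not_eq; [easy|].
  apply sqrt_lt_R0. lra.
Qed.

Lemma at_left_intro x (P Q : R -> Prop) :
  locally x P -> (forall y, P y -> y < x -> Q y) -> at_left x Q.
Proof.
  intros L H. unfold at_left, within. revert L. apply filter_imp.
  intros y Hy Hyx. now apply H.
Qed.

Lemma at_left_gt x a : a < x -> at_left x (fun y => a < y < x).
Proof.
  intros H. apply (at_left_intro x (fun y => a < y)); [|easy].
  now apply (open_gt a).
Qed.

Lemma filterlim_at_left (f : R -> R) x :
  continuous f x -> filterlim f (at_left x) (locally (f x)).
Proof.
  intros H P HP. apply (at_left_intro x (fun y => P (f y))); [now apply H|easy].
Qed.

Lemma asin_sin_ratio_at_left phi :
  0 < phi < PI / 2 ->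
  filterlim (fun b => asin (sin b / sin phi)) (at_left phi) (locally (PI / 2)).
Proof.
  intros Hphi. assert (Hs := sin_pos_quarter phi Hphi).
  intros P [e He].
  set (d := Rmin e (PI / 2) / 2).
  assert (Hd : 0 < d < e /\ d < PI / 2).
  { unfold d. pose proof (Rmin_l e (PI / 2)). pose proof (Rmin_r e (PI / 2)).
    assert (0 < Rmin e (PI / 2)) by (apply Rmin_glb_lt; [apply e|lra]). lra. }
  set (m := sin (PI / 2 - d)).
  assert (Hm : m < 1).
  { unfold m. rewrite <- sin_PI2. apply sin_increasing_1; lra. }
  assert (L : locally phi (fun b => m * sin phi < sin b /\ 0 < b)).
  { apply filter_and; [|apply (open_gt 0); lra].
    apply (continuous_sin phi (fun u => m * sin phi < u)).
    apply (open_gt (m * sin phi)). nra. }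
  apply (at_left_intro _ _ _ L).
  intros b [Hb Hb0] Hbphi.
  assert (sin b < sin phi) by (apply sin_increasing_1; lra).
  assert (0 < sin b) by (apply sin_gt_0; lra).
  assert (Hu : m < sin b / sin phi < 1).
  { split; [apply Rlt_div_r|apply Rlt_div_l]; lra. }
  assert (0 <= sin b / sin phi) by (apply Rdiv_le_0_compat; lra).
  assert (B := asin_bound (sin b / sin phi)).
  apply He. change (Rabs (asin (sin b / sin phi) - PI / 2) < e).
  assert (PI / 2 - d < asin (sin b / sin phi)).
  { apply Rnot_le_lt. intros Hle.
    assert (sin (asin (sin b / sin phi)) <= m) by (apply sin_incr_1; lra).
    rewrite sin_asin in H2 by lra. lra. }
  rewrite Rabs_left1 by lra. lra.
Qed.

(** The complete integral is the value of the improper transit up to the turning point. *)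
Lemma transit_at_left phi :
  0 < phi < PI / 2 ->
  filterlim (fun b => transit (sin phi ^ 2) 0 b) (at_left phi)
    (locally (legendreK (sin phi ^ 2))).
Proof.
  intros Hphi. assert (Hs := sin_pos_quarter phi Hphi).
  apply (filterlim_ext_loc
    (fun b => legendreF (sin phi ^ 2) (asin (sin b / sin phi)))).
  - generalize (at_left_gt phi 0 ltac:(lra)). apply filter_imp. intros b Hb.
    rewrite transit_legendreF; [| lra|].
    + rewrite <- (Rsqr_pow2 (sin phi)), sqrt_Rsqr by lra. easy.
    + split; [apply sin2_lt; lra|nra].
  - apply (filterlim_comp _ _ _ _ (legendreF (sin phi ^ 2)) _ _ _
      (asin_sin_ratio_at_left phi Hphi)).
    apply (ex_derive_continuous (legendreF (sin phi ^ 2))).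
    eexists. apply legendreF_derive. nra.
Qed.

(** For [b < phi], lowering the parameter from [s] to [sin^2 phi] increases the transit
    from [a] to [b]; then [b] tends to [phi]. *)
Lemma transit_le_legendreK phi s a :
  0 <= a < phi -> phi < PI / 2 -> sin phi ^ 2 < s < 1 ->
  transit s a phi <= legendreK (sin phi ^ 2) - transit (sin phi ^ 2) 0 a.
Proof.
  intros Ha Hphi Hs.
  apply Rle_minus_r.
  assert (Hsa : sin a ^ 2 < sin phi ^ 2) by (apply sin2_lt; lra).
  apply (filterlim_le (F := at_left phi)
    (fun b => transit s a b + transit (sin phi ^ 2) 0 a)
    (fun b => transit (sin phi ^ 2) 0 b)
    (Finite (transit s a phi + transit (sin phi ^ 2) 0 a)) (Finite (legendreK (sin phi ^ 2)))).
  - generalize (at_left_gt phi a ltac:(lra)). apply filter_imp. intros b Hb.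
    assert (sin b ^ 2 < sin phi ^ 2) by (apply sin2_lt; lra).
    rewrite <- (transit_Chasles (sin phi ^ 2) a b) by lra.
    pose proof (transit_lt (sin phi ^ 2) s a b). lra.
  - apply (filterlim_at_left (fun b => transit s a b + transit (sin phi ^ 2) 0 a)).
    { apply (continuous_plus (V := R_NormedModule)
        (fun b => transit s a b) (fun _ => transit (sin phi ^ 2) 0 a));
      [|apply continuous_const].
      apply (ex_derive_continuous (fun b => transit s a b)).
      exists (/ sqrt (s - sin phi ^ 2)).
      apply (is_derive_RInt (fun x => / sqrt (s - sin x ^ 2)) _ a).
      - assert (L : locally phi (fun b => a < b /\ b < PI / 2 /\ sin b ^ 2 < s)).
        { apply filter_and; [apply (open_gt a); lra|].
          apply filter_and; [apply (open_lt (PI / 2)); lra|].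
          apply (continuous_sin2 phi (fun u => u < s)). apply (open_lt s). lra. }
        revert L. apply filter_imp. intros b Hb.
        apply (RInt_correct (V := R_CompleteNormedModule)).
        apply transit_ex_RInt; lra.
      - apply transit_integrand_continuous. lra. }
  - apply transit_at_left. lra.
Qed.

Lemma transit_lt_legendreK s b :
  0 <= b < PI / 2 -> sin b ^ 2 < s < 1 -> transit s 0 b < legendreK s.
Proof.
  intros Hb Hs. pose proof (sin2_bounds b). rewrite transit_legendreF by lra.
  apply legendreF_lt; [lra|].
  assert (0 <= sin b) by (apply sin_ge_0; lra).
  pose proof (asin_ratio_bounds s b). apply asin_bound_lt. lra.
Qed.

(** In the variable [theta] the gap is an integral over an arc from [th] to [PI / 2] of
    an integrand at least [1], and this arc is longer than its sine,
    [cos th = sqrt ((s - sin^2 phi) / s)]. *)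
Lemma transit_le_legendreK_sqrt s phi :
  0 <= phi < PI / 2 -> sin phi ^ 2 < s < 1 ->
  transit s 0 phi <= legendreK s - sqrt (s - sin phi ^ 2).
Proof.
  intros Hphi Hs. pose proof (sin2_bounds phi). rewrite transit_legendreF by lra.
  assert (H0 : 0 <= sin phi) by (apply sin_ge_0; lra).
  assert (Hu := asin_ratio_bounds s phi ltac:(lra) H0 ltac:(lra)).
  set (th := asin (sin phi / sqrt s)).
  assert (Hth : - (PI / 2) < th < PI / 2) by (apply asin_bound_lt; lra).
  pose proof (legendreF_expanding s th (PI / 2) ltac:(lra) ltac:(lra)) as HE.
  fold (legendreK s) in HE.
  assert (cos th < PI / 2 - th).
  { rewrite cos_sin. replace (PI / 2 + th) with (PI - (PI / 2 - th)) by field.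
    rewrite sin_PI_x. apply sin_lt_x. lra. }
  assert (sqrt (s - sin phi ^ 2) <= cos th); [|lra].
  assert (0 < cos th) by (apply cos_gt_0; lra).
  rewrite <- (sqrt_Rsqr (cos th)) by lra. apply sqrt_le_1_alt.
  assert (E := sin_asin_ratio s phi ltac:(lra) H0 ltac:(lra)). fold th in E.
  pose proof (sin2_cos2 th). unfold Rsqr in *. nra.
Qed.

Lemma locally_pos_radius (x : R) (P : R -> Prop) :
  locally x P -> exists d, 0 < d /\ forall y, Rabs (y - x) < d -> P y.
Proof. intros [d Hd]. exists d. split; [apply d|exact Hd]. Qed.

(** Right semicontinuity at the end [s = sin^2 phi]: a transit up to some [b < phi]
    already approximates the complete integral, and it is continuous in [s]. *)
Lemma transit_at_right phi eps :
  0 < phi < PI / 2 -> 0 < eps ->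
  exists d, 0 < d /\ forall s, sin phi ^ 2 < s < sin phi ^ 2 + d -> s < 1 ->
    legendreK (sin phi ^ 2) - eps < transit s 0 phi.
Proof.
  intros Hphi He. set (s1 := sin phi ^ 2).
  assert (Hs1 : 0 < s1 < 1) by (pose proof (sin_pos_quarter phi Hphi); unfold s1; nra).
  assert (L : at_left phi (fun b => 0 < b /\ legendreK s1 - eps < transit s1 0 b)).
  { apply filter_and.
    - apply (at_left_intro phi (fun b => 0 < b)); [apply (open_gt 0); lra|easy].
    - apply (transit_at_left phi Hphi). fold s1.
      apply (open_gt (legendreK s1 - eps)). lra. }
  unfold at_left, within in L. apply locally_pos_radius in L.
  destruct L as [d0 [Hd0 L]].
  destruct (L (phi - d0 / 2)) as [Hb Hlt];
    [rewrite Rabs_left1; lra|lra|].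
  set (b := phi - d0 / 2) in *.
  assert (Hbp : b < phi) by (unfold b; lra).
  assert (Hsb : sin b ^ 2 < s1) by (apply sin2_lt; lra).
  assert (C : continuity_pt (fun s => transit s 0 b) s1).
  { apply (strict_convex_continuity_pt (sin b ^ 2) 1); [|lra].
    apply transit_strict_convex; lra. }
  apply continuity_pt_filterlim in C.
  specialize (C (fun u => legendreK s1 - eps < u) (open_gt (legendreK s1 - eps) _ Hlt)).
  apply locally_pos_radius in C. destruct C as [d [Hd C]].
  exists d. split; [easy|]. intros s Hs Hs'.
  specialize (C s). rewrite Rabs_pos_eq in C by lra. specialize (C ltac:(lra)).
  cbv beta in C.
  rewrite <- (transit_Chasles s b phi) by (fold s1; lra).
  pose proof (transit_pos s b phi). fold s1 in H. lra.
Qed.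

(** For [phi < PI / 2] the complete integral exceeds the transit up to [phi], which is at
    least the integral of [tan], namely [- ln (cos phi)]. *)
Lemma legendreK_unbounded M :
  exists e, 0 < e < 1 /\ forall s, e < s < 1 -> M < legendreK s.
Proof.
  set (N := Rabs M + 1).
  set (c := exp (- N)).
  assert (HN : 0 < N /\ M < N) by (unfold N; split_Rabs; lra).
  assert (Hc : 0 < c < 1).
  { unfold c. split; [apply exp_pos|]. rewrite <- exp_0. apply exp_increasing. lra. }
  set (phi := acos c).
  assert (Hphi : 0 < phi < PI / 2).
  { unfold phi. rewrite acos_asin by lra.
    pose proof (asin_bound_lt c ltac:(lra)).
    assert (0 < asin c); [|lra].
    apply Rnot_le_lt. intros Hle.
    assert (sin (asin c) <= sin 0) by (apply sin_incr_1; lra).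
    rewrite sin_asin, sin_0 in H0 by lra. lra. }
  assert (Ec : cos phi = c) by (apply cos_acos; lra).
  assert (Hs := sin_pos_quarter phi Hphi).
  exists (sin phi ^ 2). split; [nra|]. intros s Hse.
  apply Rlt_trans with (transit s 0 phi); [|apply transit_lt_legendreK; lra].
  assert (Htan : is_RInt tan 0 phi N).
  { replace N with (minus (- ln (cos phi)) (- ln (cos 0))).
    2:{ unfold minus, plus, opp; simpl. rewrite cos_0, ln_1, Ec. unfold c.
        rewrite ln_exp. ring. }
    apply (is_RInt_derive (fun x => - ln (cos x)) tan);
    rewrite Rmin_left, Rmax_right by lra; intros x Hx;
    assert (0 < cos x) by (apply cos_gt_0; lra).
    - auto_derive; [easy|]. unfold tan. field. lra.
    - apply (ex_derive_continuous tan). unfold tan. auto_derive. lra. }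
  apply Rlt_le_trans with N; [lra|].
  rewrite <- (is_RInt_unique _ _ _ _ Htan).
  apply RInt_le; [lra| | |].
  - eexists; exact Htan.
  - apply transit_ex_RInt; lra.
  - intros x Hx.
    assert (Hcx : 0 < cos x) by (apply cos_gt_0; lra).
    assert (Hr : 0 < s - sin x ^ 2) by (apply (transit_radicand_pos s phi); lra).
    assert (Hsx := sin_pos_quarter x ltac:(lra)).
    apply Rle_trans with (/ cos x).
    + unfold tan, Rdiv. assert (0 < / cos x) by now apply Rinv_0_lt_compat. nra.
    + apply Rinv_le_contravar; [now apply sqrt_lt_R0|].
      rewrite <- (sqrt_Rsqr (cos x)) by lra. apply sqrt_le_1_alt.
      pose proof (sin2_cos2 x). unfold Rsqr in *. lra.
Qed.

(** * Times as elliptic integrals *)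

Lemma sqrt_energy alpha x :
  sqrt (cos (2 * x) - cos (2 * alpha)) = sqrt 2 * sqrt (sin alpha ^ 2 - sin x ^ 2).
Proof.
  rewrite <- sqrt_mult_alt by lra. f_equal. rewrite !cos_2a_sin. ring.
Qed.

Lemma RInt_gen_at_left (f Phi : R -> R) phi l :
  0 < phi ->
  (forall b, 0 < b < phi -> is_RInt f 0 b (Phi b)) ->
  filterlim Phi (at_left phi) (locally l) ->
  RInt_gen f (at_point 0) (at_left phi) = l.
Proof.
  intros Hphi HI HL.
  apply (is_RInt_gen_unique (V := R_CompleteNormedModule)).
  intros P HP. specialize (HL P HP).
  apply (Filter_prod _ _ _ (fun a => a = 0) (fun b => P (Phi b) /\ 0 < b < phi)).
  - reflexivity.
  - apply filter_and; [exact HL|].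
    now apply at_left_gt.
  - intros a b -> [Hb Hb']. exists (Phi b). split; [now apply HI|easy].
Qed.

Lemma T1_integral alpha b :
  0 <= b < alpha -> alpha < PI / 2 ->
  is_RInt (fun x => / sqrt (cos (2 * x) - cos (2 * alpha))) 0 b
    (/ sqrt 2 * transit (sin alpha ^ 2) 0 b).
Proof.
  intros Hb Ha.
  apply (is_RInt_ext (fun x => scal (/ sqrt 2) (/ sqrt (sin alpha ^ 2 - sin x ^ 2)))).
  - intros x _. rewrite sqrt_energy, Rinv_mult. reflexivity.
  - apply (is_RInt_scal (V := R_NormedModule)).
    apply (RInt_correct (V := R_CompleteNormedModule)).
    apply transit_ex_RInt; [lra|lra|]. apply sin2_lt; lra.
Qed.

Lemma T1_transit alpha phi :
  0 < phi < alpha -> alpha < PI / 2 ->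
  T1 alpha phi = / sqrt 2 * transit (sin alpha ^ 2) 0 phi.
Proof.
  intros Hphi Ha.
  apply (RInt_gen_at_left _ (fun b => / sqrt 2 * transit (sin alpha ^ 2) 0 b)); [lra| |].
  - intros b Hb. apply T1_integral; lra.
  - apply (filterlim_at_left (fun b => / sqrt 2 * transit (sin alpha ^ 2) 0 b)).
    apply (ex_derive_continuous (fun b => / sqrt 2 * transit (sin alpha ^ 2) 0 b)).
    exists (/ sqrt (cos (2 * phi) - cos (2 * alpha))).
    apply (is_derive_RInt (fun x => / sqrt (cos (2 * x) - cos (2 * alpha))) _ 0).
    + assert (L : locally phi (fun b => 0 < b /\ b < alpha)).
      { apply filter_and; [apply (open_gt 0); lra|apply (open_lt alpha); lra]. }
      revert L. apply filter_imp. intros b Hb. apply T1_integral; lra.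
    + assert (sin phi ^ 2 < sin alpha ^ 2) by (apply sin2_lt; lra).
      apply (continuous_inv_sqrt (fun x => cos (2 * x) - cos (2 * alpha))).
      * apply (ex_derive_continuous (fun x => cos (2 * x) - cos (2 * alpha))).
        now auto_derive.
      * rewrite !cos_2a_sin. lra.
Qed.

Lemma T_legendreK alpha :
  0 < alpha < PI / 2 -> T alpha = / sqrt 2 * legendreK (sin alpha ^ 2).
Proof.
  intros Ha.
  apply (RInt_gen_at_left _ (fun b => / sqrt 2 * transit (sin alpha ^ 2) 0 b)); [lra| |].
  - intros b Hb. apply T1_integral; lra.
  - apply (filterlim_comp _ _ _ (fun b => transit (sin alpha ^ 2) 0 b)
      (fun u => / sqrt 2 * u) _ (locally (legendreK (sin alpha ^ 2)))).
    + now apply transit_at_left.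
    + apply (continuous_scal_r (V := R_NormedModule) (/ sqrt 2) (fun u : R => u)).
      apply continuous_id.
Qed.

(** * Sums of times near the two ends of the energy range *)

(** Up to the factor [1 / sqrt 2], this is the time of type A for [c = 4 k] and [sg = 1],
    and the time of type C-left for [c = 4 k + 2] and [sg = -1]. *)
Definition time_sum (phi0 phi1 c sg s : R) : R :=
  c * legendreK s + transit s 0 phi1 + sg * transit s 0 phi0.

(** The value of [time_sum] at [s = sin^2 phi1], where the transit up to [phi1] becomes a
    complete integral. *)
Definition time_sum_limit (phi0 phi1 c sg : R) : R :=
  (c + 1) * legendreK (sin phi1 ^ 2) + sg * transit (sin phi1 ^ 2) 0 phi0.

(** The chord of a convex function over the fixed interval from [s1] to [s2] bounds it from
    above. *)
Lemma legendreK_Lipschitz_right s1 s2 : 0 < s1 -> s1 < s2 -> s2 < 1 ->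
  exists C, 0 < C /\ forall s, s1 < s < s2 -> legendreK s - legendreK s1 <= C * (s - s1).
Proof.
  intros H1 H12 H2.
  assert (Q : legendreK s1 < legendreK s2) by (apply legendreK_lt; lra).
  exists ((legendreK s2 - legendreK s1) / (s2 - s1)).
  split; [apply Rdiv_lt_0_compat; lra|].
  intros s Hs. set (C := (legendreK s2 - legendreK s1) / (s2 - s1)).
  assert (EC : C * (s2 - s1) = legendreK s2 - legendreK s1) by (unfold C; field; lra).
  assert (C1 := strict_convex_chord 0 1 legendreK s1 s s2 legendreK_strict_convex
    ltac:(lra) ltac:(lra) ltac:(lra) H2).
  apply (Rmult_le_reg_l (s2 - s1)); [lra|].
  replace ((s2 - s1) * (C * (s - s1))) with ((s - s1) * (C * (s2 - s1))) by ring.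
  rewrite EC. lra.
Qed.

(** The chord of a convex function over an interval on the left of [s1], prolonged to the
    right, bounds it from below. *)
Lemma transit_Lipschitz_right phi s1 :
  0 < phi < PI / 2 -> sin phi ^ 2 < s1 -> s1 < 1 ->
  exists C, 0 < C /\ forall s, s1 < s < 1 ->
    0 < transit s1 0 phi - transit s 0 phi <= C * (s - s1).
Proof.
  intros Hphi H1 H1'.
  set (u := (sin phi ^ 2 + s1) / 2).
  assert (Hu : sin phi ^ 2 < u < s1) by (unfold u; lra).
  assert (Q : transit s1 0 phi < transit u 0 phi) by (apply transit_lt; lra).
  exists ((transit u 0 phi - transit s1 0 phi) / (s1 - u)).
  split; [apply Rdiv_lt_0_compat; lra|].
  intros s Hs. set (C := (transit u 0 phi - transit s1 0 phi) / (s1 - u)).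
  assert (EC : C * (s1 - u) = transit u 0 phi - transit s1 0 phi) by (unfold C; field; lra).
  split; [assert (transit s 0 phi < transit s1 0 phi) by (apply transit_lt; lra); lra|].
  assert (C1 := strict_convex_chord _ 1 (fun s => transit s 0 phi) u s1 s
    (transit_strict_convex 0 phi ltac:(lra) ltac:(lra))
    ltac:(lra) ltac:(lra) ltac:(lra) ltac:(lra)). cbv beta in C1.
  apply (Rmult_le_reg_l (s1 - u)); [lra|].
  replace ((s1 - u) * (C * (s - s1))) with ((s - s1) * (C * (s1 - u))) by ring.
  rewrite EC. lra.
Qed.

(** With [h = sqrt (s - s1)], the square-root gap lowers the sum by [h], and the Lipschitz
    terms raise it by at most a multiple of [h^2]. *)
Lemma time_sum_dip phi0 phi1 c sg :
  0 < phi0 < phi1 -> phi1 < PI / 2 -> 0 < c -> -1 <= sg <= 1 ->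
  exists d, 0 < d /\ sin phi1 ^ 2 + d < 1 /\
    forall s, sin phi1 ^ 2 < s < sin phi1 ^ 2 + d ->
      time_sum phi0 phi1 c sg s < time_sum_limit phi0 phi1 c sg.
Proof.
  intros Hphi Hphi1 Hc Hsg. set (s1 := sin phi1 ^ 2).
  assert (Hs1 : 0 < s1 < 1).
  { unfold s1. pose proof (sin_pos_quarter phi1 ltac:(lra)). split; nra. }
  assert (Hs01 : sin phi0 ^ 2 < s1) by (apply sin2_lt; lra).
  destruct (legendreK_Lipschitz_right s1 ((s1 + 1) / 2)) as [CK [HCK LK]]; try lra.
  destruct (transit_Lipschitz_right phi0 s1) as [CI [HCI LI]]; try lra.
  set (C := (c + 1) * CK + CI + 1).
  assert (HC : 0 < C) by (unfold C; nra).
  set (d := Rmin ((1 - s1) / 2) (/ C ^ 2)).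
  assert (Hd : 0 < d).
  { apply Rmin_glb_lt; [lra|]. now apply Rinv_0_lt_compat, pow_lt. }
  assert (Hd1 : d <= (1 - s1) / 2) by apply Rmin_l.
  assert (Hd2 : d <= / C ^ 2) by apply Rmin_r.
  exists d. split; [easy|split; [lra|]]. intros s Hs.
  assert (QK := LK s ltac:(lra)). assert (QI := LI s ltac:(lra)).
  assert (Q1 := transit_le_legendreK_sqrt s phi1 ltac:(lra) ltac:(fold s1; lra)).
  fold s1 in Q1.
  assert (S := sqrt_lt_R0 (s - s1) ltac:(lra)).
  assert (Es := sqrt_sqrt (s - s1) ltac:(lra)).
  unfold time_sum, time_sum_limit. fold s1.
  set (h := sqrt (s - s1)) in *.
  assert (Hsmall : C * h < 1).
  { apply Rsqr_incrst_0; [|nra|lra]. rewrite Rsqr_mult, Rsqr_1.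
    replace (h²) with (s - s1) by (unfold Rsqr; lra).
    apply Rlt_le_trans with (C² * / C ^ 2).
    - apply Rmult_lt_compat_l; [unfold Rsqr; nra|lra].
    - apply Req_le. unfold Rsqr. field. lra. }
  assert ((c + 1) * (legendreK s - legendreK s1) <= (c + 1) * CK * (h * h)).
  { rewrite Rmult_assoc, Es. apply Rmult_le_compat_l; lra. }
  assert (sg * (transit s 0 phi0 - transit s1 0 phi0) <= CI * (h * h)).
  { rewrite Es. nra. }
  assert (((c + 1) * CK + CI) * (h * h) < h).
  { apply Rle_lt_trans with ((C * h) * h); [unfold C; nra|nra]. }
  lra.
Qed.

Lemma time_sum_unbounded phi0 phi1 c sg :
  0 < phi0 < phi1 -> phi1 < PI / 2 -> 0 < c -> -1 <= sg <= 1 ->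
  forall M, exists e, sin phi1 ^ 2 < e < 1 /\
    forall s, e < s < 1 -> M < time_sum phi0 phi1 c sg s.
Proof.
  intros Hphi Hphi1 Hc Hsg M.
  destruct (legendreK_unbounded (M / c)) as [e [He HK]].
  assert (H1 : sin phi1 ^ 2 < 1).
  { pose proof (sin_pos_quarter phi1 ltac:(lra)). nra. }
  exists (Rmax e ((sin phi1 ^ 2 + 1) / 2)).
  split.
  { split; [|apply Rmax_lub_lt; lra].
    apply Rlt_le_trans with (2 := Rmax_r _ _). lra. }
  intros s Hs.
  assert (R1 := Rmax_l e ((sin phi1 ^ 2 + 1) / 2)).
  assert (R2 := Rmax_r e ((sin phi1 ^ 2 + 1) / 2)).
  assert (Q := HK s ltac:(lra)).
  apply Rlt_div_l in Q; [|lra].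
  assert (sin phi0 ^ 2 < sin phi1 ^ 2) by (apply sin2_lt; lra).
  assert (I1 := transit_pos s phi0 phi1 ltac:(lra) ltac:(lra) ltac:(lra)).
  assert (I2 := transit_Chasles s phi0 phi1 ltac:(lra) ltac:(lra) ltac:(lra)).
  assert (I3 := transit_pos s 0 phi0 ltac:(lra) ltac:(lra) ltac:(lra)).
  unfold time_sum. nra.
Qed.

(** Some value [x2] lies below the limit at the left end, and values closer to that end come
    back near the limit. *)
Lemma time_sum_descends phi0 phi1 c sg :
  0 < phi0 < phi1 -> phi1 < PI / 2 -> 0 < c -> -1 <= sg <= 1 ->
  exists x1 x2, sin phi1 ^ 2 < x1 /\ x1 < x2 /\ x2 < 1 /\
    time_sum phi0 phi1 c sg x2 < time_sum phi0 phi1 c sg x1.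
Proof.
  intros Hphi Hphi1 Hc Hsg. set (s1 := sin phi1 ^ 2).
  assert (Hs1 : 0 < s1 < 1).
  { unfold s1. pose proof (sin_pos_quarter phi1 ltac:(lra)). split; nra. }
  assert (Hs01 : sin phi0 ^ 2 < s1) by (apply sin2_lt; lra).
  destruct (time_sum_dip phi0 phi1 c sg Hphi Hphi1 Hc Hsg) as [d [Hd [Hd1 Hdip]]].
  fold s1 in Hd1, Hdip.
  set (x2 := s1 + d / 2). assert (Q2 := Hdip x2 ltac:(unfold x2; lra)).
  set (V := time_sum_limit phi0 phi1 c sg) in *.
  set (eps := (V - time_sum phi0 phi1 c sg x2) / 2).
  assert (Heps : 0 < eps) by (unfold eps; lra).
  destruct (transit_at_right phi1 eps) as [d1 [Hd1' HI]]; try lra. fold s1 in HI.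
  destruct (transit_Lipschitz_right phi0 s1) as [CI [HCI LI]]; try lra.
  set (h := Rmin (d / 2) (Rmin d1 (eps / CI)) / 2).
  assert (He : 0 < eps / CI) by (apply Rdiv_lt_0_compat; lra).
  assert (Hh : 0 < h /\ h < d / 2 /\ h < d1 /\ h < eps / CI).
  { unfold h. pose proof (Rmin_l (d / 2) (Rmin d1 (eps / CI))).
    pose proof (Rmin_r (d / 2) (Rmin d1 (eps / CI))).
    pose proof (Rmin_l d1 (eps / CI)). pose proof (Rmin_r d1 (eps / CI)).
    assert (0 < Rmin (d / 2) (Rmin d1 (eps / CI)))
      by (repeat apply Rmin_glb_lt; lra). lra. }
  destruct Hh as [Hh [Hh1 [Hh2 Hh3]]].
  exists (s1 + h), x2. unfold x2 in *. repeat split; try lra.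
  assert (Q1 := HI (s1 + h) ltac:(lra) ltac:(lra)).
  assert (QI := LI (s1 + h) ltac:(lra)).
  replace (s1 + h - s1) with h in QI by ring.
  apply Rlt_div_r in Hh3; [|lra].
  assert (QK := legendreK_lt s1 (s1 + h) ltac:(lra) ltac:(lra) ltac:(lra)).
  assert (EV : V = (c + 1) * legendreK s1 + sg * transit s1 0 phi0) by reflexivity.
  assert (sg * (transit s1 0 phi0 - transit (s1 + h) 0 phi0) <= eps) by nra.
  unfold eps in *. unfold time_sum at 2. nra.
Qed.

Lemma time_sum_valley phi0 phi1 c sg :
  0 < phi0 < phi1 -> phi1 < PI / 2 -> 0 < c -> -1 <= sg <= 1 ->
  strict_convex_on (sin phi1 ^ 2) 1 (time_sum phi0 phi1 c sg) ->
  exists s, valley (sin phi1 ^ 2) 1 (time_sum phi0 phi1 c sg) s.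
Proof.
  intros Hphi Hphi1 Hc Hsg Hconv.
  destruct (time_sum_descends phi0 phi1 c sg Hphi Hphi1 Hc Hsg)
    as [x1 [x2 [H1 [H12 [H2 Hlt]]]]].
  apply (strict_convex_valley _ _ _ x1 x2); try easy.
  now apply time_sum_unbounded.
Qed.

Lemma legendreK_strict_convex_right phi : strict_convex_on (sin phi ^ 2) 1 legendreK.
Proof.
  apply (strict_convex_on_subset 0 1); [apply sin2_bounds|lra|].
  apply legendreK_strict_convex.
Qed.

Lemma time_sum_plus_strict_convex phi0 phi1 c :
  0 < phi0 < phi1 -> phi1 < PI / 2 -> 0 < c ->
  strict_convex_on (sin phi1 ^ 2) 1 (time_sum phi0 phi1 c 1).
Proof.
  intros Hphi Hphi1 Hc.
  apply (strict_convex_on_ext _ _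
    (fun s => c * legendreK s + transit s 0 phi1 + transit s 0 phi0)).
  { intros s _. unfold time_sum. ring. }
  apply (strict_convex_on_plus _ _ (fun s => c * legendreK s + transit s 0 phi1)).
  - apply (strict_convex_on_plus _ _ (fun s => c * legendreK s)).
    + now apply strict_convex_on_scal, legendreK_strict_convex_right.
    + apply transit_strict_convex; lra.
  - apply (strict_convex_on_subset (sin phi0 ^ 2) 1); [apply sin2_le; lra|lra|].
    apply transit_strict_convex; lra.
Qed.

(** The transit up to [phi0] is subtracted, but together with the transit up to [phi1] it
    leaves the transit from [phi0] to [phi1]. *)
Lemma time_sum_minus_strict_convex phi0 phi1 c :
  0 < phi0 < phi1 -> phi1 < PI / 2 -> 0 < c ->
  strict_convex_on (sin phi1 ^ 2) 1 (time_sum phi0 phi1 c (-1)).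
Proof.
  intros Hphi Hphi1 Hc.
  apply (strict_convex_on_ext _ _ (fun s => c * legendreK s + transit s phi0 phi1)).
  { intros s Hs. unfold time_sum. rewrite <- (transit_Chasles s phi0 phi1) by lra. ring. }
  apply (strict_convex_on_plus _ _ (fun s => c * legendreK s)).
  - now apply strict_convex_on_scal, legendreK_strict_convex_right.
  - apply transit_strict_convex; lra.
Qed.

(** * From the energy to the amplitude *)

Lemma sin2_amplitude phi alpha :
  0 < phi < alpha -> alpha < PI / 2 -> sin phi ^ 2 < sin alpha ^ 2 < 1.
Proof.
  intros H Ha. split; [apply sin2_lt; lra|].
  pose proof (sin_pos_quarter alpha ltac:(lra)). nra.
Qed.

Lemma asin_sqrt_amplitude phi s :
  0 < phi < PI / 2 -> sin phi ^ 2 < s < 1 ->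
  phi < asin (sqrt s) < PI / 2 /\ sin (asin (sqrt s)) ^ 2 = s.
Proof.
  intros Hphi Hs. pose proof (sin2_bounds phi).
  assert (S := sqrt_lt_R0 s ltac:(lra)).
  assert (E := sqrt_sqrt s ltac:(lra)).
  assert (sqrt s < 1) by nra.
  assert (Es : sin (asin (sqrt s)) = sqrt s) by (apply sin_asin; lra).
  assert (B := asin_bound_lt (sqrt s) ltac:(lra)).
  split; [split; [|lra]|rewrite Es; nra].
  apply Rnot_le_lt. intros Hle.
  assert (sin (asin (sqrt s)) <= sin phi) by (apply sin_incr_1; lra).
  nra.
Qed.

Lemma at_right_amplitude phi d (P Q : R -> Prop) :
  0 < phi < PI / 2 -> 0 < d ->
  (forall s, sin phi ^ 2 < s < sin phi ^ 2 + d -> P s) ->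
  (forall alpha, phi < alpha < PI / 2 -> P (sin alpha ^ 2) -> Q alpha) ->
  at_right phi Q.
Proof.
  intros Hphi Hd HP HQ.
  assert (L : locally phi (fun a => a < PI / 2 /\ sin a ^ 2 < sin phi ^ 2 + d)).
  { apply filter_and; [apply (open_lt (PI / 2)); lra|].
    apply (continuous_sin2 phi (fun u => u < sin phi ^ 2 + d)).
    apply (open_lt (sin phi ^ 2 + d)). lra. }
  unfold at_right, within. revert L. apply filter_imp.
  intros a [Ha Hs] Hpa. apply HQ; [lra|]. apply HP. split; [apply sin2_lt; lra|easy].
Qed.

Lemma filterlim_amplitude phi (f g : R -> R) :
  0 < phi < PI / 2 ->
  (forall M, exists e, sin phi ^ 2 < e < 1 /\ forall s, e < s < 1 -> M < f s) ->
  (forall alpha, phi < alpha < PI / 2 -> g alpha = / sqrt 2 * f (sin alpha ^ 2)) ->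
  filterlim g (at_left (PI / 2)) (Rbar_locally p_infty).
Proof.
  intros Hphi Hf Hg P [M HM].
  destruct (Hf (sqrt 2 * M)) as [e [He Hs]].
  assert (S2 := sqrt_lt_R0 2 ltac:(lra)).
  apply (at_left_intro (PI / 2) (fun a => phi < a /\ e < sin a ^ 2)).
  - apply filter_and; [apply (open_gt phi); lra|].
    apply (continuous_sin2 (PI / 2) (fun u => e < u)).
    apply (open_gt e). rewrite sin_PI2. lra.
  - intros a [Ha Hea] Hap. apply HM. rewrite Hg by lra.
    assert (Q := Hs (sin a ^ 2)
      (conj Hea (proj2 (sin2_amplitude phi a ltac:(lra) ltac:(lra))))).
    apply (Rmult_lt_reg_l (sqrt 2)); [easy|].
    rewrite <- Rmult_assoc, Rinv_r, Rmult_1_l by lra. easy.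
Qed.

(** * Convexity of the time in the initial speed *)

(** The second derivative in [w] of [r^(-1/2)], where [r] is the sum of [w^2] and a
    constant. *)
Definition bend (w r : R) : R := - / sqrt r ^ 3 + 3 * w ^ 2 * / sqrt r ^ 5.

(** Let [tan theta = sin x / sqrt (s - sin^2 x)], that is [sin x = sqrt s * sin theta]. With
    [M = tan theta * (w^2 tan^2 theta + 3 w^2 - s)], the form [bend dx] is
    [dM / (s^2 cos x)], and the function below is [M / (s^2 cos x)]; the variation of
    [1 / cos x] is the second term of [bend_primitive_derive]. *)
Definition bend_primitive (s w x : R) : R :=
  tan x * ((w ^ 2 * s + (2 * w ^ 2 - s) * (s - sin x ^ 2)) /
    (s ^ 2 * sqrt (s - sin x ^ 2) ^ 3)).

Lemma bend_primitive_derive s w x :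
  0 < s -> 0 < cos x -> 0 < s - sin x ^ 2 ->
  is_derive (bend_primitive s w) x
    (bend w (s - sin x ^ 2) +
     tan x ^ 2 * ((w ^ 2 * s + (2 * w ^ 2 - s) * (s - sin x ^ 2)) /
       (s ^ 2 * sqrt (s - sin x ^ 2) ^ 3))).
Proof.
  intros Hs Hc Hr. assert (S := sqrt_lt_R0 _ Hr).
  assert (E := sqrt_sqrt _ (Rlt_le _ _ Hr)).
  unfold bend_primitive, bend, tan. auto_derive.
  - change (sin x * (sin x * 1)) with (sin x ^ 2). unfold Rminus in *.
    repeat split; try lra.
    apply Rgt_not_eq. repeat apply Rmult_lt_0_compat; lra.
  - change (sin x * (sin x * 1)) with (sin x ^ 2). unfold Rminus in *.
    set (q := sqrt (s + - sin x ^ 2)) in *. clearbody q.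
    assert (Es : s = q * q + sin x ^ 2) by lra.
    set (a := sin x) in *. set (b := cos x) in *.
    clearbody a b. subst s. field. split; lra.
Qed.

Lemma sin2_Delta3_continuous s th : 0 <= s < 1 ->
  continuous (fun th => sin th ^ 2 * / sqrt (1 - s * sin th ^ 2) ^ 3) th.
Proof.
  intros Hs. pose proof (legendreF_radicand_pos s th Hs).
  apply (ex_derive_continuous (fun th => sin th ^ 2 * / sqrt (1 - s * sin th ^ 2) ^ 3)).
  auto_derive. change (sin th * (sin th * 1)) with (sin th ^ 2).
  assert (S := sqrt_lt_R0 _ H). unfold Rminus in *.
  repeat split; try lra. apply Rgt_not_eq. repeat apply Rmult_lt_0_compat; lra.
Qed.

(** In the variable [theta], the left-hand side is the integral of the right-hand integrand
    over a shorter interval. *)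
Lemma RInt_tan2 s b :
  0 <= b < PI / 2 -> sin b ^ 2 < s < 1 ->
  RInt (fun x => tan x ^ 2 * / (s * sqrt (s - sin x ^ 2))) 0 b <=
  RInt (fun th => sin th ^ 2 * / sqrt (1 - s * sin th ^ 2) ^ 3) 0 (PI / 2).
Proof.
  intros Hb Hs. pose proof (sin2_bounds b) as Bb.
  set (h := fun th => sin th ^ 2 * / sqrt (1 - s * sin th ^ 2) ^ 3).
  assert (Ch : forall th, continuous h th).
  { intros th. apply sin2_Delta3_continuous. lra. }
  assert (Ih : forall u v, ex_RInt h u v).
  { intros u v. apply (ex_RInt_continuous (V := R_CompleteNormedModule)).
    intros z _. apply Ch. }
  set (th0 := asin (sin b / sqrt s)).
  assert (H0 : 0 <= sin b) by (apply sin_ge_0; lra).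
  assert (Bu := asin_ratio_bounds s b ltac:(lra) H0 ltac:(lra)).
  assert (Bth : th0 <= PI / 2) by apply asin_bound.
  apply Rle_trans with (RInt h 0 th0).
  - apply Req_le. unfold th0. rewrite <- RInt_sin_subst; [|easy|lra|lra].
    apply RInt_ext. rewrite Rmin_left, Rmax_right by lra. intros x Hx.
    assert (sin x ^ 2 <= sin b ^ 2) by (apply sin2_le; lra).
    assert (Hsx : 0 <= sin x) by (apply sin_ge_0; lra).
    assert (Hcx : 0 < cos x) by (apply cos_gt_0; lra).
    assert (Q := sin_asin_ratio s x ltac:(lra) Hsx ltac:(lra)).
    unfold h. rewrite Q.
    replace (sin (asin (sin x / sqrt s)) ^ 2) with (sin x ^ 2 / s).
    2:{ rewrite <- Q. field. lra. }
    replace (1 - sin x ^ 2) with ((cos x)²).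
    2:{ pose proof (sin2_cos2 x). unfold Rsqr in *. lra. }
    rewrite sqrt_Rsqr by lra. unfold tan.
    eq_in_R.
    assert (S := sqrt_lt_R0 (s - sin x ^ 2) ltac:(lra)).
    field. repeat split; lra.
  - rewrite <- (RInt_Chasles (V := R_CompleteNormedModule) h 0 th0 (PI / 2)) by apply Ih.
    assert (0 <= RInt h th0 (PI / 2)).
    { apply RInt_ge_0; [easy|apply Ih|]. intros x _. unfold h.
      apply Rmult_le_pos; [apply sin2_bounds|].
      apply Rlt_le, Rinv_0_lt_compat, pow_lt, sqrt_lt_R0, legendreF_radicand_pos. lra. }
    unfold plus; simpl. lra.
Qed.

Lemma bend_continuous s w x :
  0 < s - sin x ^ 2 -> continuous (fun x => bend w (s - sin x ^ 2)) x.
Proof.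
  intros H. assert (S := sqrt_lt_R0 _ H).
  apply (ex_derive_continuous (fun x => bend w (s - sin x ^ 2))). unfold bend.
  auto_derive. change (sin x * (sin x * 1)) with (sin x ^ 2). unfold Rminus in *.
  repeat split; try lra; apply Rgt_not_eq; repeat apply Rmult_lt_0_compat; lra.
Qed.

(** Let [P] be [bend_primitive]. It vanishes at [0] and is positive at [phi], and on the
    interval [r = s - sin^2 x >= w^2], whence [bend >= P' - 2 tan^2 x / (s sqrt r)]. The
    last term is integrated by [RInt_tan2]. *)
Lemma RInt_bend_lower phi s w :
  0 < phi < PI / 2 -> 0 < w -> s = sin phi ^ 2 + w ^ 2 -> s < 1 ->
  - 2 * RInt (fun th => sin th ^ 2 * / sqrt (1 - s * sin th ^ 2) ^ 3) 0 (PI / 2) <=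
  RInt (fun x => bend w (s - sin x ^ 2)) 0 phi.
Proof.
  intros Hphi Hw Es Hs1.
  assert (Hsp := sin_pos_quarter phi Hphi).
  assert (Hw2 : 0 < w ^ 2) by now apply pow_lt.
  assert (Hsphi : 0 < sin phi ^ 2) by (apply pow_lt; lra).
  assert (Hs : 0 < s) by lra.
  assert (Hr : forall x, 0 <= x <= phi -> 0 < s - sin x ^ 2).
  { intros x Hx. apply (transit_radicand_pos s phi); lra. }
  assert (Hc : forall x, 0 <= x <= phi -> 0 < cos x).
  { intros x Hx. apply cos_gt_0; lra. }
  set (e := fun x => (w ^ 2 * s + (2 * w ^ 2 - s) * (s - sin x ^ 2)) /
       (s ^ 2 * sqrt (s - sin x ^ 2) ^ 3)).
  set (g := fun x => tan x ^ 2 * / (s * sqrt (s - sin x ^ 2))).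
  assert (Cg : forall x, 0 <= x <= phi -> continuous g x).
  { intros x Hx. specialize (Hr x Hx). specialize (Hc x Hx).
    assert (S := sqrt_lt_R0 _ Hr). apply (ex_derive_continuous g). unfold g, tan.
    auto_derive. change (sin x * (sin x * 1)) with (sin x ^ 2). unfold Rminus in *.
    repeat split; try lra. apply Rgt_not_eq, Rmult_lt_0_compat; lra. }
  assert (Ce : forall x, 0 <= x <= phi -> continuous (fun x => tan x ^ 2 * e x) x).
  { intros x Hx. specialize (Hr x Hx). specialize (Hc x Hx).
    assert (S := sqrt_lt_R0 _ Hr).
    apply (ex_derive_continuous (fun x => tan x ^ 2 * e x)). unfold e, tan.
    auto_derive. change (sin x * (sin x * 1)) with (sin x ^ 2). unfold Rminus in *.
    repeat split; try lra. apply Rgt_not_eq.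
    repeat apply Rmult_lt_0_compat; lra. }
  assert (Cb : forall x, 0 <= x <= phi ->
             continuous (fun x => bend w (s - sin x ^ 2)) x).
  { intros x Hx. apply bend_continuous, Hr, Hx. }
  assert (I : forall f : R -> R, (forall x, 0 <= x <= phi -> continuous f x) ->
            ex_RInt f 0 phi).
  { intros f Hf. apply (ex_RInt_continuous (V := R_CompleteNormedModule)).
    rewrite Rmin_left, Rmax_right by lra. exact Hf. }
  assert (HP : is_RInt (fun x => bend w (s - sin x ^ 2) + tan x ^ 2 * e x) 0 phi
                 (bend_primitive s w phi - bend_primitive s w 0)).
  { apply (is_RInt_derive (bend_primitive s w)
      (fun x => bend w (s - sin x ^ 2) + tan x ^ 2 * e x));
    rewrite Rmin_left, Rmax_right by lra; intros x Hx.
    - apply bend_primitive_derive; [easy|apply Hc|apply Hr]; easy.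
    - apply (continuous_plus (V := R_NormedModule)
        (fun x => bend w (s - sin x ^ 2)) (fun x => tan x ^ 2 * e x));
      [apply Cb|apply Ce]; easy. }
  assert (P0 : bend_primitive s w 0 = 0).
  { unfold bend_primitive. rewrite tan_0. ring. }
  assert (P1 : 0 <= bend_primitive s w phi).
  { unfold bend_primitive. replace (s - sin phi ^ 2) with (w ^ 2) by lra.
    apply Rmult_le_pos; [apply Rlt_le, tan_gt_0; lra|].
    apply Rdiv_le_0_compat.
    - replace (w ^ 2 * s + (2 * w ^ 2 - s) * w ^ 2) with (2 * w ^ 2 * w ^ 2) by ring.
      nra.
    - apply Rmult_lt_0_compat; [now apply pow_lt|].
      now apply pow_lt, sqrt_lt_R0. }
  pose proof (RInt_tan2 s phi ltac:(lra) ltac:(lra)) as HT. fold g in HT.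
  apply Rle_trans with (- 2 * RInt g 0 phi); [lra|].
  apply (is_RInt_unique (V := R_CompleteNormedModule)) in HP.
  apply Rle_trans with
    (RInt (fun x => bend w (s - sin x ^ 2) + tan x ^ 2 * e x) 0 phi +
     - 2 * RInt g 0 phi); [lra|].
  assert (Eg : RInt (fun x => scal (- (2)) (g x)) 0 phi = - 2 * RInt g 0 phi).
  { apply (RInt_scal (V := R_CompleteNormedModule) g 0 phi (- (2))), I, Cg. }
  rewrite <- Eg.
  rewrite <- (RInt_plus (V := R_CompleteNormedModule)).
  2:{ apply I. intros x Hx.
      apply (continuous_plus (V := R_NormedModule)
        (fun x => bend w (s - sin x ^ 2)) (fun x => tan x ^ 2 * e x));
      [apply Cb|apply Ce]; easy. }
  2:{ apply (ex_RInt_scal (V := R_CompleteNormedModule)), I, Cg. }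
  apply RInt_le; [lra| |now apply I|].
  - apply (ex_RInt_plus (V := R_CompleteNormedModule)).
    + apply I. intros x Hx.
      apply (continuous_plus (V := R_NormedModule)
        (fun x => bend w (s - sin x ^ 2)) (fun x => tan x ^ 2 * e x));
      [apply Cb|apply Ce]; easy.
    + apply (ex_RInt_scal (V := R_CompleteNormedModule)), I, Cg.
  - intros x Hx. unfold plus, scal; simpl; unfold mult; cbn -[pow].
    assert (Hrx := Hr x ltac:(lra)).
    assert (Hrw : w ^ 2 <= s - sin x ^ 2).
    { pose proof (sin2_le x phi). lra. }
    assert (e x <= 2 * / (s * sqrt (s - sin x ^ 2))).
    { unfold e. assert (S := sqrt_lt_R0 _ Hrx).
      assert (Eq := sqrt_sqrt _ (Rlt_le _ _ Hrx)).
      set (q := sqrt (s - sin x ^ 2)) in *. set (r := s - sin x ^ 2) in *.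
      replace (2 * / (s * q)) with (2 * s * r / (s ^ 2 * q ^ 3)).
      - apply Rmult_le_compat_r; [|nra].
        apply Rlt_le, Rinv_0_lt_compat, Rmult_lt_0_compat; now apply pow_lt.
      - rewrite <- Eq. field. lra. }
    assert (0 <= tan x ^ 2) by apply pow2_ge_0.
    unfold g. nra.
Qed.

(** The second derivative is at least [c k2 - 2 k2 - 2 k2], where [k2] is the integral in
    [RInt_bend_lower]. The part of the transit between [phi0] and [phi1] has a nonnegative
    [bend], for [s - sin^2 x <= w^2] there. *)
Lemma total_time_convex_in_speed phi0 phi1 c :
  0 < phi0 < phi1 -> phi1 < PI / 2 -> 4 <= c ->
  convex_on (sqrt (sin phi1 ^ 2 - sin phi0 ^ 2)) (sqrt (1 - sin phi0 ^ 2))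
    (fun w => c * legendreK (sin phi0 ^ 2 + w ^ 2) + transit (sin phi0 ^ 2 + w ^ 2) 0 phi0 +
              transit (sin phi0 ^ 2 + w ^ 2) 0 phi1).
Proof.
  intros Hphi Hphi1 Hc.
  set (s0 := sin phi0 ^ 2). set (s1 := sin phi1 ^ 2).
  assert (Hs01 : s0 < s1) by (apply sin2_lt; lra).
  assert (Hs1 : s1 < 1).
  { unfold s1. pose proof (sin_pos_quarter phi1 ltac:(lra)). nra. }
  assert (Hs0 : 0 < s0).
  { unfold s0. pose proof (sin_pos_quarter phi0 ltac:(lra)). nra. }
  set (lo := sqrt (s1 - s0)). set (hi := sqrt (1 - s0)).
  assert (Hlo : 0 < lo) by (apply sqrt_lt_R0; lra).
  assert (Hw : forall w, lo < w < hi -> s1 < s0 + w ^ 2 < 1).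
  { intros w Hw. assert (E1 := sqrt_sqrt (s1 - s0) ltac:(lra)).
    assert (E2 := sqrt_sqrt (1 - s0) ltac:(lra)).
    fold lo in E1. fold hi in E2. split; nra. }
  set (AK := fun th => 1 - s0 * sin th ^ 2). set (BK := fun th => - sin th ^ 2).
  set (AI := fun x => s0 - sin x ^ 2). set (BI := fun _ : R => 1).
  assert (CAK : forall x, continuous AK x).
  { intros x. apply (ex_derive_continuous AK). unfold AK. now auto_derive. }
  assert (CBK : forall x, continuous BK x).
  { intros x. apply (ex_derive_continuous BK). unfold BK. now auto_derive. }
  assert (CAI : forall x, continuous AI x).
  { intros x. apply (ex_derive_continuous AI). unfold AI. now auto_derive. }
  assert (CBI : forall x, continuous BI x) by (intros x; apply continuous_const).
  assert (PP := PI_RGT_0).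
  assert (PK : forall w x, lo < w < hi -> 0 <= x <= PI / 2 ->
             0 < AK x + BK x * w ^ 2).
  { intros w x H _. specialize (Hw w H). unfold AK, BK.
    pose proof (legendreF_radicand_pos (s0 + w ^ 2) x ltac:(lra)). lra. }
  assert (PI1 : forall w x, lo < w < hi -> 0 <= x <= phi1 ->
             0 < AI x + BI x * w ^ 2).
  { intros w x H Hx. specialize (Hw w H). unfold AI, BI.
    pose proof (transit_radicand_pos (s0 + w ^ 2) phi1 x ltac:(lra) ltac:(lra)
      ltac:(fold s1; lra)). lra. }
  assert (PI0 : forall w x, lo < w < hi -> 0 <= x <= phi0 ->
             0 < AI x + BI x * w ^ 2) by (intros; apply PI1; lra).
  assert (DK := RInt_inv_sqrt_quadratic_derive AK BK 0 (PI / 2) lo hi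
    ltac:(lra) CAK CBK PK).
  assert (D0 := RInt_inv_sqrt_quadratic_derive AI BI 0 phi0 lo hi
    ltac:(lra) CAI CBI PI0).
  assert (D1 := RInt_inv_sqrt_quadratic_derive AI BI 0 phi1 lo hi
    ltac:(lra) CAI CBI PI1).
  set (J := fun A B b w => RInt (fun x : R => / sqrt (A x + B x * w ^ 2)) 0 b) in *.
  set (J1 := fun A B b w => RInt (fun x : R => - (B x * w) *
    / sqrt (A x + B x * w ^ 2) ^ 3) 0 b).
  set (J2 := fun A B b w => RInt (fun x : R => - B x * / sqrt (A x + B x * w ^ 2) ^ 3 +
    3 * (B x * w) ^ 2 * / sqrt (A x + B x * w ^ 2) ^ 5) 0 b).
  assert (Conv : convex_on lo hi
    (fun w => c * J AK BK (PI / 2) w + J AI BI phi0 w + J AI BI phi1 w)).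
  { apply (convex_on_derive2 _
      (fun w => c * J1 AK BK (PI / 2) w + J1 AI BI phi0 w + J1 AI BI phi1 w)
      (fun w => c * J2 AK BK (PI / 2) w + J2 AI BI phi0 w + J2 AI BI phi1 w)).
    - intros w H.
      destruct (DK w H) as [DKa DKb]. destruct (D0 w H) as [D0a D0b].
      destruct (D1 w H) as [D1a D1b].
      exact (is_derive_plus (K := R_AbsRing) (V := R_NormedModule) _ _ w _ _
        (is_derive_plus (K := R_AbsRing) (V := R_NormedModule) _ _ w _ _
          (is_derive_scal _ w c _ DKa) D0a) D1a).
    - intros w H.
      destruct (DK w H) as [DKa DKb]. destruct (D0 w H) as [D0a D0b].
      destruct (D1 w H) as [D1a D1b].
      exact (is_derive_plus (K := R_AbsRing) (V := R_NormedModule) _ _ w _ _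
        (is_derive_plus (K := R_AbsRing) (V := R_NormedModule) _ _ w _ _
          (is_derive_scal _ w c _ DKb) D0b) D1b).
    - intros w H. specialize (Hw w H). set (s := s0 + w ^ 2) in *.
      set (k2 := RInt (fun th => sin th ^ 2 * / sqrt (1 - s * sin th ^ 2) ^ 3)
                   0 (PI / 2)).
      assert (E2 : forall b, J2 AI BI b w = RInt (fun x => bend w (s - sin x ^ 2)) 0 b).
      { intros b. apply RInt_ext. intros x _. unfold AI, BI, bend.
        replace (s0 - sin x ^ 2 + 1 * w ^ 2) with (s - sin x ^ 2) by (unfold s; ring).
        eq_in_R. ring. }
      assert (B0 : - 2 * k2 <= J2 AI BI phi0 w).
      { rewrite E2. apply RInt_bend_lower; try easy; lra. }
      assert (Ib : forall a b, 0 <= a <= b -> b <= phi1 ->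
                 ex_RInt (fun x => bend w (s - sin x ^ 2)) a b).
      { intros a b Hab Hb. apply (ex_RInt_continuous (V := R_CompleteNormedModule)).
        rewrite Rmin_left, Rmax_right by lra. intros x Hx. apply bend_continuous.
        apply (transit_radicand_pos s phi1); try lra. fold s1. lra. }
      assert (B1 : J2 AI BI phi0 w <= J2 AI BI phi1 w).
      { rewrite !E2.
        assert (Ech : RInt (fun x => bend w (s - sin x ^ 2)) 0 phi0 +
                      RInt (fun x => bend w (s - sin x ^ 2)) phi0 phi1 =
                      RInt (fun x => bend w (s - sin x ^ 2)) 0 phi1).
        { apply (RInt_Chasles (V := R_CompleteNormedModule)); apply Ib; lra. }
        assert (0 <= RInt (fun x => bend w (s - sin x ^ 2)) phi0 phi1); [|lra].
        apply RInt_ge_0; [lra|apply Ib; lra|]. intros x Hx.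
        assert (Hr : 0 < s - sin x ^ 2).
        { apply (transit_radicand_pos s phi1); try lra. fold s1. lra. }
        assert (Hrw : s - sin x ^ 2 <= w ^ 2).
        { unfold s, s0. pose proof (sin2_le phi0 x). lra. }
        unfold bend. assert (S := sqrt_lt_R0 _ Hr).
        assert (Eq := sqrt_sqrt _ (Rlt_le _ _ Hr)).
        set (q := sqrt (s - sin x ^ 2)) in *.
        replace (- / q ^ 3 + 3 * w ^ 2 * / q ^ 5) with ((3 * w ^ 2 - q * q) / q ^ 5)
          by (field; lra).
        apply Rdiv_le_0_compat; [|now apply pow_lt]. rewrite Eq. nra. }
      assert (BK' : k2 <= J2 AK BK (PI / 2) w).
      { assert (G : forall x, 0 < 1 - s * sin x ^ 2).
        { intros x. apply legendreF_radicand_pos. lra. }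
        assert (Er : forall x, AK x + BK x * w ^ 2 = 1 - s * sin x ^ 2).
        { intros x. unfold AK, BK, s. ring. }
        apply RInt_le; [lra| | |].
        - apply (ex_RInt_continuous (V := R_CompleteNormedModule)).
          intros x _. apply sin2_Delta3_continuous. lra.
        - apply (ex_RInt_continuous (V := R_CompleteNormedModule)). intros x _.
          specialize (G x). assert (S := sqrt_lt_R0 _ G).
          apply (continuous_ext (fun x => sin x ^ 2 * / sqrt (1 - s * sin x ^ 2) ^ 3 +
             3 * (sin x ^ 2 * w) ^ 2 * / sqrt (1 - s * sin x ^ 2) ^ 5)).
          { intros y. rewrite Er. unfold BK.
            eq_in_R. ring. }
          apply (ex_derive_continuous (fun x =>
             sin x ^ 2 * / sqrt (1 - s * sin x ^ 2) ^ 3 +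
             3 * (sin x ^ 2 * w) ^ 2 * / sqrt (1 - s * sin x ^ 2) ^ 5)).
          auto_derive. change (sin x * (sin x * 1)) with (sin x ^ 2).
          unfold Rminus in *.
          repeat split; try lra; apply Rgt_not_eq;
          repeat apply Rmult_lt_0_compat; lra.
        - intros x _. rewrite Er. unfold BK.
          assert (0 < / sqrt (1 - s * sin x ^ 2) ^ 5).
          { apply Rinv_0_lt_compat, pow_lt, sqrt_lt_R0, G. }
          assert (0 <= (- sin x ^ 2 * w) ^ 2) by apply pow2_ge_0.
          nra. }
      assert (0 <= k2).
      { apply RInt_ge_0; [lra| |].
        - apply (ex_RInt_continuous (V := R_CompleteNormedModule)).
          intros x _. apply sin2_Delta3_continuous. lra.
        - intros x _. apply Rmult_le_pos; [apply sin2_bounds|].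
          apply Rlt_le, Rinv_0_lt_compat, pow_lt, sqrt_lt_R0, legendreF_radicand_pos.
          lra. }
      nra. }
  assert (EK : forall w, legendreK (s0 + w ^ 2) = J AK BK (PI / 2) w).
  { intros w. apply RInt_ext. intros x _. f_equal; f_equal. unfold AK, BK. ring. }
  assert (EI : forall w b, transit (s0 + w ^ 2) 0 b = J AI BI b w).
  { intros w b. apply RInt_ext. intros x _. f_equal; f_equal. unfold AI, BI. ring. }
  intros x y t Hx Hy Ht. rewrite !EK, !EI. now apply Conv.
Qed.

(** * Angles, quadrants and turns *)

Definition is_angle (th p q : R) : Prop :=
  p = sqrt (p ^ 2 + q ^ 2) * cos th /\ q = sqrt (p ^ 2 + q ^ 2) * sin th.

(** The determination of the angle of [(p, q)] nearest to [th]: the correction is the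
    angle between [(p, q)] and the unit vector of angle [th], computed from their cross and
    dot products. *)
Definition lift (th p q : R) : R :=
  th + atan ((q * cos th - p * sin th) / (p * cos th + q * sin th)).

Lemma lift_is_angle th p q :
  0 < p * cos th + q * sin th ->
  is_angle (lift th p q) p q /\ Rabs (lift th p q - th) < PI / 2.
Proof.
  intros HX. unfold is_angle, lift.
  set (X := p * cos th + q * sin th) in *.
  set (Y := q * cos th - p * sin th).
  assert (E1 := sin2_cos2 th). unfold Rsqr in E1.
  assert (ER : p ^ 2 + q ^ 2 = X ^ 2 + Y ^ 2).
  { unfold X, Y.
    replace ((p * cos th + q * sin th) ^ 2 + (q * cos th - p * sin th) ^ 2)
      with ((p ^ 2 + q ^ 2) * (sin th * sin th + cos th * cos th)) by ring.
    rewrite E1. ring. }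
  set (r := sqrt (p ^ 2 + q ^ 2)).
  assert (Hr : 0 < r) by (apply sqrt_lt_R0; rewrite ER; nra).
  assert (Ea : sqrt (1 + (Y / X)²) = r / X).
  { replace (1 + (Y / X)²) with ((p ^ 2 + q ^ 2) / (X * X))
      by (rewrite ER; unfold Rsqr; field; lra).
    rewrite sqrt_div_alt by nra. rewrite sqrt_square by lra. reflexivity. }
  split; [|].
  - rewrite cos_plus, sin_plus, sin_atan, cos_atan, Ea. split.
    + replace (r * (cos th * (1 / (r / X)) - sin th * (Y / X / (r / X))))
        with (cos th * X - sin th * Y) by (field; lra).
      unfold X, Y.
      replace (cos th * (p * cos th + q * sin th) -
               sin th * (q * cos th - p * sin th))
        with (p * (sin th * sin th + cos th * cos th)) by ring.
      rewrite E1. ring.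
    + replace (r * (sin th * (1 / (r / X)) + cos th * (Y / X / (r / X))))
        with (sin th * X + cos th * Y) by (field; lra).
      unfold X, Y.
      replace (sin th * (p * cos th + q * sin th) +
               cos th * (q * cos th - p * sin th))
        with (q * (sin th * sin th + cos th * cos th)) by ring.
      rewrite E1. ring.
  - pose proof (atan_bound (Y / X)). split_Rabs; lra.
Qed.

Lemma lift_continuous (th p q : R -> R) t :
  continuous th t -> continuous p t -> continuous q t ->
  0 < p t * cos (th t) + q t * sin (th t) ->
  continuous (fun u => lift (th u) (p u) (q u)) t.
Proof.
  intros Ht Hp Hq HX. unfold lift.
  assert (Hc : continuous (fun u => cos (th u)) t).
  { apply (continuous_comp th cos); [easy|apply continuous_cos]. }
  assert (Hs : continuous (fun u => sin (th u)) t).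
  { apply (continuous_comp th sin); [easy|apply continuous_sin]. }
  apply (continuous_plus (V := R_NormedModule) th); [easy|].
  apply continuous_atan_comp.
  apply (continuous_mult (fun u => q u * cos (th u) - p u * sin (th u))
    (fun u => / (p u * cos (th u) + q u * sin (th u)))).
  - apply (continuous_minus (V := R_NormedModule)
      (fun u => q u * cos (th u)) (fun u => p u * sin (th u)));
    now apply (continuous_mult (K := R_AbsRing)).
  - apply (continuous_comp (fun u => p u * cos (th u) + q u * sin (th u)) Rinv).
    + apply (continuous_plus (V := R_NormedModule)
        (fun u => p u * cos (th u)) (fun u => q u * sin (th u)));
      now apply (continuous_mult (K := R_AbsRing)).
    + apply continuous_Rinv. lra.
Qed.

Lemma period_Z x (j : Z) :
  sin (x + 2 * IZR j * PI) = sin x /\ cos (x + 2 * IZR j * PI) = cos x.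
Proof.
  destruct (Z.le_gt_cases 0 j) as [H|H].
  - rewrite <- (Z2Nat.id j) by lia. rewrite <- INR_IZR_INZ.
    split; [apply sin_period|apply cos_period].
  - assert (E : x = (x + 2 * IZR j * PI) + 2 * INR (Z.to_nat (- j)) * PI).
    { rewrite INR_IZR_INZ, Z2Nat.id by lia. rewrite opp_IZR. ring. }
    set (z := x + 2 * IZR j * PI) in *. rewrite E.
    split; symmetry; [apply sin_period|apply cos_period].
Qed.

Lemma reduce_angle th : exists j : Z, 0 <= th - 2 * IZR j * PI < 2 * PI.
Proof.
  assert (P := PI_RGT_0).
  destruct (euclidian_division th (2 * PI)) as [j [r [E Hr]]]; [lra|].
  rewrite Rabs_pos_eq in Hr by lra. exists j. lra.
Qed.

Lemma second_quadrant th :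
  cos th < 0 -> 0 < sin th ->
  exists j : Z, PI / 2 < th - 2 * IZR j * PI < PI.
Proof.
  intros Hc Hs. assert (P := PI_RGT_0).
  destruct (reduce_angle th) as [j Hj]. exists j.
  destruct (period_Z (th - 2 * IZR j * PI) j) as [E1 E2].
  replace (th - 2 * IZR j * PI + 2 * IZR j * PI) with th in E1, E2 by ring.
  set (r := th - 2 * IZR j * PI) in *. split.
  - apply Rnot_le_lt. intros H. assert (0 <= cos r) by (apply cos_ge_0; lra). lra.
  - apply Rnot_le_lt. intros H. assert (sin r <= 0) by (apply sin_le_0; lra). lra.
Qed.

Lemma first_quadrant th :
  0 < cos th -> 0 < sin th ->
  exists j : Z, 0 < th - 2 * IZR j * PI < PI / 2.
Proof.
  intros Hc Hs. assert (P := PI_RGT_0).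
  destruct (second_quadrant (th + PI / 2)) as [j Hj].
  - replace (th + PI / 2) with (PI / 2 - - th) by ring. rewrite cos_shift, sin_neg. lra.
  - replace (th + PI / 2) with (PI / 2 - - th) by ring. rewrite sin_shift, cos_neg. lra.
  - exists j. lra.
Qed.

Lemma IZR_close (i j : Z) : -1 < IZR i - IZR j < 1 -> i = j.
Proof.
  intros H. rewrite <- minus_IZR in H. apply one_IZR_lt1 in H. lia.
Qed.

(** Distinct translates of an open quadrant by multiples of [2 * PI] are at least
    [3 * PI / 2] apart, so that two close angles lie in the same one. *)
Lemma second_quadrant_near th om :
  cos th < 0 -> 0 < sin th -> cos om < 0 -> 0 < sin om -> Rabs (th - om) < PI / 2 ->
  exists j : Z, PI / 2 < th - 2 * IZR j * PI < PI /\
                PI / 2 < om - 2 * IZR j * PI < PI.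
Proof.
  intros H1 H2 H3 H4 H. assert (P := PI_RGT_0).
  destruct (second_quadrant th H1 H2) as [j Hj].
  destruct (second_quadrant om H3 H4) as [i Hi].
  exists j. split; [easy|].
  replace j with i; [easy|]. apply IZR_close.
  assert (- PI < 2 * (IZR i - IZR j) * PI < PI) by (split_Rabs; lra).
  split; nra.
Qed.

Lemma first_quadrant_near th om :
  0 < cos th -> 0 < sin th -> 0 < cos om -> 0 < sin om -> Rabs (th - om) < PI / 2 ->
  exists j : Z, 0 < th - 2 * IZR j * PI < PI / 2 /\
                0 < om - 2 * IZR j * PI < PI / 2.
Proof.
  intros H1 H2 H3 H4 H. assert (P := PI_RGT_0).
  destruct (first_quadrant th H1 H2) as [j Hj].
  destruct (first_quadrant om H3 H4) as [i Hi].
  exists j. split; [easy|].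
  replace j with i; [easy|]. apply IZR_close.
  assert (- PI < 2 * (IZR i - IZR j) * PI < PI) by (split_Rabs; lra).
  split; nra.
Qed.

Lemma is_angle_signs th p q :
  is_angle th p q -> 0 < p ^ 2 + q ^ 2 ->
  (0 < p -> 0 < cos th) /\ (p < 0 -> cos th < 0) /\ (0 < q -> 0 < sin th).
Proof.
  intros [Hp Hq] H. assert (S := sqrt_lt_R0 _ H).
  set (r := sqrt (p ^ 2 + q ^ 2)) in *. repeat split; intros; nra.
Qed.

(** Near [t], continuity gives [om u - om t = asin (sin (om u - om t))], and the right-hand
    side is differentiable. *)
Lemma angle_derive (om : R -> R) (t ds dc : R) :
  continuous om t ->
  is_derive (fun u => sin (om u)) t ds ->
  is_derive (fun u => cos (om u)) t dc ->
  is_derive om t (ds * cos (om t) - dc * sin (om t)).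
Proof.
  intros C Hs Hc.
  assert (P := PI_RGT_0).
  set (g := fun u => sin (om u) * cos (om t) - cos (om u) * sin (om t)).
  apply (is_derive_ext_loc (fun u => om t + asin (g u))).
  - assert (Hp : 0 < PI / 2) by lra.
    assert (L : locally t (fun u => ball (om t) (mkposreal _ Hp) (om u))).
    { exact (C _ (locally_ball (om t) (mkposreal _ Hp))). }
    revert L. apply filter_imp. intros u Hu.
    change (Rabs (om u - om t) < PI / 2) in Hu.
    unfold g. rewrite <- sin_minus, asin_sin; [eq_in_R; ring|split_Rabs; lra].
  - assert (Hg : is_derive g t (ds * cos (om t) - dc * sin (om t))).
    { apply (is_derive_minus (V := R_NormedModule)
        (fun u => sin (om u) * cos (om t)) (fun u => cos (om u) * sin (om t))).
      - apply (is_derive_ext (fun u => cos (om t) * sin (om u)));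
          [intros u; apply Rmult_comm|].
        replace (ds * cos (om t)) with (cos (om t) * ds) by ring.
        now apply is_derive_scal.
      - apply (is_derive_ext (fun u => sin (om t) * cos (om u)));
          [intros u; apply Rmult_comm|].
        replace (dc * sin (om t)) with (sin (om t) * dc) by ring.
        now apply is_derive_scal. }
    assert (Ha : is_derive asin (g t) 1).
    { assert (E0 : g t = 0) by (unfold g; ring). rewrite E0.
      assert (H0 : -1 < 0 < 1) by lra.
      apply is_derive_Reals.
      apply (derive_pt_eq_1 _ _ _ (derivable_pt_asin 0 H0)).
      rewrite derive_pt_asin. unfold Rsqr.
      replace (1 - 0 * 0) with 1 by ring. rewrite sqrt_1. field. }
    assert (H := is_derive_comp asin g t _ _ Ha Hg).
    assert (H' := is_derive_plus (V := R_NormedModule) (fun _ => om t) _ t _ _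
      (is_derive_const (om t) t) H).
    match type of H' with is_derive _ _ ?l =>
      replace l with (ds * cos (om t) - dc * sin (om t)) in H' end; [exact H'|].
    unfold plus, zero, scal; simpl; unfold mult; simpl. ring.
Qed.

(** * Symmetries and inverse of the incomplete integral *)

Lemma legendreF_0 s : legendreF s 0 = 0.
Proof. apply (RInt_point (V := R_CompleteNormedModule)). Qed.

Lemma legendreF_comp_derive s (u : R -> R) z du :
  0 <= s < 1 -> is_derive u z du ->
  is_derive (fun z => legendreF s (u z)) z (du * / sqrt (1 - s * sin (u z) ^ 2)).
Proof.
  intros Hs Hu.
  apply (is_derive_comp (legendreF s) u); [now apply legendreF_derive|easy].
Qed.

Lemma derive_0_const (f : R -> R) a b :
  (forall z, is_derive f z 0) -> f a = f b.
Proof.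
  intros H. destruct (Rtotal_order a b) as [L|[->|L]]; [|easy|].
  - apply eq_is_derive; [intros z _; apply H|easy].
  - symmetry. apply eq_is_derive; [intros z _; apply H|easy].
Qed.

Lemma legendreF_opp s z : 0 <= s < 1 -> legendreF s (- z) = - legendreF s z.
Proof.
  intros Hs.
  assert (E : legendreF s (- z) + legendreF s z = legendreF s (- 0) + legendreF s 0).
  { apply (derive_0_const (fun z => legendreF s (- z) + legendreF s z)). intros u.
    replace 0 with (-1 * / sqrt (1 - s * sin (- u) ^ 2) +
                    / sqrt (1 - s * sin u ^ 2)).
    - apply (is_derive_plus (V := R_NormedModule) (fun z => legendreF s (- z)) (legendreF s)).
      + apply legendreF_comp_derive; [easy|]. now auto_derive.
      + now apply legendreF_derive.
    - rewrite sin_neg. replace ((- sin u) ^ 2) with (sin u ^ 2) by ring. ring. }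
  rewrite Ropp_0, legendreF_0 in E. lra.
Qed.

Lemma legendreF_PI s z :
  0 <= s < 1 -> legendreF s (z + PI) = legendreF s z + 2 * legendreK s.
Proof.
  intros Hs.
  assert (E : legendreF s (z + PI) - legendreF s z =
              legendreF s (- (PI / 2) + PI) - legendreF s (- (PI / 2))).
  { apply (derive_0_const (fun z => legendreF s (z + PI) - legendreF s z)). intros u.
    replace 0 with (1 * / sqrt (1 - s * sin (u + PI) ^ 2) -
                    / sqrt (1 - s * sin u ^ 2)).
    - apply (is_derive_minus (V := R_NormedModule) (fun z => legendreF s (z + PI)) (legendreF s)).
      + apply (legendreF_comp_derive s (fun z => z + PI)); [easy|]. now auto_derive.
      + now apply legendreF_derive.
    - rewrite neg_sin. replace ((- sin u) ^ 2) with (sin u ^ 2) by ring. ring. }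
  rewrite legendreF_opp in E by easy.
  replace (- (PI / 2) + PI) with (PI / 2) in E by field. unfold legendreK. lra.
Qed.

Lemma legendreF_turns_nat s z (n : nat) :
  0 <= s < 1 ->
  legendreF s (z + 2 * INR n * PI) = legendreF s z + 4 * INR n * legendreK s.
Proof.
  intros Hs. induction n as [|n IH].
  - simpl. replace (z + 2 * 0 * PI) with z by ring. ring.
  - rewrite S_INR. replace (z + 2 * (INR n + 1) * PI)
      with (z + 2 * INR n * PI + PI + PI) by ring.
    rewrite !legendreF_PI, IH by easy. ring.
Qed.

Lemma legendreF_turns s z (j : Z) :
  0 <= s < 1 ->
  legendreF s (z + 2 * IZR j * PI) = legendreF s z + 4 * IZR j * legendreK s.
Proof.
  intros Hs. destruct (Z.le_gt_cases 0 j) as [H|H].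
  - rewrite <- (Z2Nat.id j) by lia. rewrite <- INR_IZR_INZ. now apply legendreF_turns_nat.
  - assert (Ej : IZR j = - INR (Z.to_nat (- j))).
    { rewrite INR_IZR_INZ, Z2Nat.id by lia. rewrite opp_IZR. ring. }
    rewrite Ej. set (n := Z.to_nat (- j)).
    assert (Q := legendreF_turns_nat s (z + 2 * - INR n * PI) n Hs).
    replace (z + 2 * - INR n * PI + 2 * INR n * PI) with z in Q by ring. lra.
Qed.

(** The function [am] is Jacobi's amplitude. It exists because [legendreF s] is
    expanding. *)
Lemma legendreF_inverse s :
  0 <= s < 1 ->
  exists am : R -> R, (forall t, legendreF s (am t) = t) /\
    forall t, is_derive am t (sqrt (1 - s * sin (am t) ^ 2)).
Proof.
  intros Hs.
  assert (HC : continuity (legendreF s)).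
  { intros z. apply continuity_pt_filterlim, (ex_derive_continuous (legendreF s)).
    eexists. now apply legendreF_derive. }
  assert (X : forall t, {z : R | legendreF s z = t}).
  { intros t. destruct (IVT (fun z => legendreF s z - t) (- (Rabs t + 1)) (Rabs t + 1))
      as [z [_ Hz]].
    - intros z. apply continuity_pt_minus; [apply HC|].
      apply continuity_pt_const. intros u v. reflexivity.
    - pose proof (Rabs_pos t). lra.
    - pose proof (legendreF_expanding s (- (Rabs t + 1)) 0 Hs
        ltac:(pose proof (Rabs_pos t); lra)) as Q.
      rewrite legendreF_0 in Q. split_Rabs; lra.
    - pose proof (legendreF_expanding s 0 (Rabs t + 1) Hs
        ltac:(pose proof (Rabs_pos t); lra)) as Q.
      rewrite legendreF_0 in Q. split_Rabs; lra.
    - exists z. lra. }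
  set (am := fun t => proj1_sig (X t)).
  assert (HE : forall t, legendreF s (am t) = t) by (intros t; apply (proj2_sig (X t))).
  exists am. split; [easy|]. intros t.
  assert (Lip : forall u, Rabs (am u - am t) <= Rabs (u - t)).
  { intros u. destruct (Rle_lt_dec (am t) (am u)) as [L|L].
    - assert (Q := legendreF_expanding s (am t) (am u) Hs L). rewrite !HE in Q.
      split_Rabs; lra.
    - assert (Q := legendreF_expanding s (am u) (am t) Hs ltac:(lra)). rewrite !HE in Q.
      split_Rabs; lra. }
  set (D := fun z => sqrt (1 - s * sin z ^ 2)).
  assert (HD : forall z, 0 < D z).
  { intros z. apply sqrt_lt_R0. now apply legendreF_radicand_pos. }
  assert (CD : continuous D (am t)).
  { apply (ex_derive_continuous D). unfold D. auto_derive.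
    assert (Q := legendreF_radicand_pos s (am t) Hs). simpl in Q. lra. }
  (* the mean value theorem for [legendreF] evaluates the difference quotient of [am] *)
  assert (MV : forall u, exists z, Rabs (z - am t) <= Rabs (u - t) /\
                 am u - am t = D z * (u - t)).
  { intros u.
    destruct (MVT_gen (legendreF s) (am t) (am u) (fun z => / D z)) as [z [Hz E]].
    - intros z _. now apply legendreF_derive.
    - intros z _. apply HC.
    - exists z. rewrite !HE in E. split.
      + apply Rle_trans with (2 := Lip u). revert Hz.
        unfold Rmin, Rmax. destruct (Rle_dec (am t) (am u)); split_Rabs; lra.
      + rewrite E. field. apply Rgt_not_eq, HD. }
  apply is_derive_Reals. intros eps Heps.
  destruct (CD _ (locally_ball (D (am t)) (mkposreal eps Heps))) as [d Hd].
  exists d. intros h Hh Hhd.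
  destruct (MV (t + h)) as [z [Hz E]].
  replace (t + h - t) with h in Hz, E by ring.
  rewrite E. replace (D z * h / h - sqrt (1 - s * sin (am t) ^ 2))
    with (D z - D (am t)) by (unfold D; field; easy).
  apply Hd. change (Rabs (z - am t) < d). lra.
Qed.

(** * Orbits of type A *)

(** Freezing a function outside an interval turns continuity on the interval into
    continuity on the line. *)
Definition clamp (a b t : R) : R := Rmax a (Rmin b t).

Lemma clamp_in a b t : a <= b -> a <= clamp a b t <= b.
Proof.
  intros H. unfold clamp, Rmax, Rmin.
  destruct (Rle_dec b t); destruct (Rle_dec a _); lra.
Qed.

Lemma clamp_id a b t : a <= t <= b -> clamp a b t = t.
Proof.
  intros H. unfold clamp. rewrite Rmin_right by lra. apply Rmax_right. lra.
Qed.

Lemma clamp_lipschitz a b t u :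
  a <= b -> Rabs (clamp a b u - clamp a b t) <= Rabs (u - t).
Proof.
  intros H. unfold clamp, Rmax, Rmin.
  destruct (Rle_dec b t); destruct (Rle_dec b u);
  repeat destruct (Rle_dec a _); split_Rabs; lra.
Qed.

Lemma clamp_continuous (f : R -> R) a b :
  a <= b -> continuous_on (fun t => a <= t <= b) f ->
  forall t, continuous (fun u => f (clamp a b u)) t.
Proof.
  intros H Hf t P HP.
  destruct (Hf (clamp a b t) (clamp_in a b t H) P HP) as [d Hd].
  exists d. intros u Hu. apply Hd; [|now apply clamp_in].
  change (Rabs (clamp a b u - clamp a b t) < d).
  change (Rabs (u - t) < d) in Hu.
  pose proof (clamp_lipschitz a b t u H). lra.
Qed.

Lemma clamp_derive (f : R -> R) a b t l :
  a < t < b -> is_derive f t l -> is_derive (fun u => f (clamp a b u)) t l.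
Proof.
  intros Ht Hf. apply (is_derive_ext_loc f); [|easy].
  assert (L : locally t (fun u => a < u /\ u < b)).
  { apply filter_and; [apply (open_gt a); lra|apply (open_lt b); lra]. }
  revert L. apply filter_imp. intros u Hu. rewrite clamp_id; [easy|lra].
Qed.

(** The angle [theta] at which the orbit of energy [s] passes the abscissa [phi], in
    [sin x = sqrt s * sin theta]. *)
Definition amplitude (s phi : R) : R := asin (sin phi / sqrt s).

Lemma amplitude_spec s phi :
  0 < phi < PI / 2 -> sin phi ^ 2 < s ->
  0 < amplitude s phi < PI / 2 /\ sqrt s * sin (amplitude s phi) = sin phi.
Proof.
  intros Hphi Hs. pose proof (sin_pos_quarter phi Hphi) as H.
  pose proof (pow_lt (sin phi) 2 ltac:(lra)).
  assert (S := sqrt_lt_R0 s ltac:(lra)).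
  assert (B := asin_ratio_bounds s phi ltac:(lra) ltac:(lra) Hs).
  assert (E : sin (amplitude s phi) = sin phi / sqrt s) by (apply sin_asin; lra).
  assert (Hb := asin_bound_lt (sin phi / sqrt s) ltac:(lra)).
  fold (amplitude s phi) in Hb.
  split; [split; [|lra]|rewrite E; field; lra].
  apply Rnot_le_lt. intros Hle.
  assert (sin (amplitude s phi) <= sin 0) by (apply sin_incr_1; lra).
  rewrite E, sin_0 in H1.
  assert (0 < sin phi / sqrt s) by (apply Rdiv_lt_0_compat; lra). lra.
Qed.

(** The angle satisfies [om' = - sqrt 2 * cos x], and [cos x] is the square root in the
    integrand of [legendreF s] at [PI / 2 - om]. So [legendreF s (PI / 2 - om)] grows at
    the constant rate [sqrt 2]. *)
Lemma pendulum_arc_time s L (x y om : R -> R) :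
  0 < s < 1 -> 0 < L ->
  (forall t, continuous om t) ->
  (forall t, sin (x t) = sqrt s * cos (om t) /\
             y t = sqrt 2 * sqrt s * sin (om t) /\ 0 < cos (x t)) ->
  (forall t, - L < t < L -> is_derive x t (y t) /\ is_derive y t (- sin (2 * x t))) ->
  legendreF s (PI / 2 - om L) - legendreF s (PI / 2 - om (- L)) = sqrt 2 * (2 * L).
Proof.
  intros Hs HL Com Hrel Hder.
  assert (Sm := sqrt_lt_R0 s ltac:(lra)). assert (Em := sqrt_sqrt s ltac:(lra)).
  assert (S2 := sqrt_lt_R0 2 ltac:(lra)). assert (E2 := sqrt_sqrt 2 ltac:(lra)).
  set (m := sqrt s) in *. set (r2 := sqrt 2) in *.
  assert (Dom : forall t, - L < t < L -> is_derive om t (- r2 * cos (x t))).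
  { intros t Ht. destruct (Hder t Ht) as [Hx Hy].
    destruct (Hrel t) as [R1 [R2 R3]].
    assert (Ds : is_derive (fun u => sin (om u)) t (/ (r2 * m) * - sin (2 * x t))).
    { apply (is_derive_ext (fun u => / (r2 * m) * y u)).
      - intros u. destruct (Hrel u) as [_ [Q _]]. rewrite Q. eq_in_R. field. lra.
      - now apply is_derive_scal. }
    assert (Dc : is_derive (fun u => cos (om u)) t (/ m * (y t * cos (x t)))).
    { apply (is_derive_ext (fun u => / m * sin (x u))).
      - intros u. destruct (Hrel u) as [Q _]. rewrite Q. eq_in_R. field. lra.
      - apply is_derive_scal. apply (is_derive_comp sin x); [|easy].
        apply is_derive_sin. }
    assert (Q := angle_derive om t _ _ (Com t) Ds Dc).
    replace (- r2 * cos (x t)) with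
      (/ (r2 * m) * - sin (2 * x t) * cos (om t) -
       / m * (y t * cos (x t)) * sin (om t)); [exact Q|].
    rewrite sin_2a, R1, R2. pose proof (sin2_cos2 (om t)) as P. unfold Rsqr in P.
    replace (/ (r2 * m) * - (2 * (m * cos (om t)) * cos (x t)) * cos (om t) -
      / m * (r2 * m * sin (om t) * cos (x t)) * sin (om t))
      with (- cos (x t) * (2 / r2 * (cos (om t) * cos (om t)) +
                           r2 * (sin (om t) * sin (om t)))) by (field; lra).
    replace (2 / r2) with r2 by (rewrite <- E2; field; lra).
    rewrite <- Rmult_plus_distr_l.
    replace (cos (om t) * cos (om t) + sin (om t) * sin (om t)) with 1 by lra. ring. }
  destruct (MVT_gen (fun t => legendreF s (PI / 2 - om t)) (- L) L (fun _ => r2))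
    as [c [_ E]].
  - rewrite Rmin_left, Rmax_right by lra. intros t Ht.
    destruct (Hrel t) as [R1 [R2 R3]].
    replace r2 with (r2 * cos (x t) * / sqrt (1 - s * sin (PI / 2 - om t) ^ 2)).
    + apply (legendreF_comp_derive s (fun t => PI / 2 - om t)); [lra|].
      replace (r2 * cos (x t)) with (0 - - r2 * cos (x t)) by ring.
      apply (is_derive_minus (V := R_NormedModule) (fun _ => PI / 2) om);
        [apply (is_derive_const (V := R_NormedModule))|now apply Dom].
    + rewrite sin_shift.
      replace (1 - s * cos (om t) ^ 2) with ((cos (x t))²).
      * rewrite sqrt_Rsqr by lra. field. lra.
      * pose proof (sin2_cos2 (x t)) as P. rewrite R1 in P. unfold Rsqr in *.
        rewrite <- Em. lra.
  - intros t _. apply continuity_pt_filterlim.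
    apply (continuous_comp (fun t => PI / 2 - om t) (legendreF s)).
    + apply (continuous_minus (V := R_NormedModule) (fun _ => PI / 2) om);
      [apply continuous_const|apply Com].
    + apply (ex_derive_continuous (legendreF s)). eexists. apply legendreF_derive. lra.
  - rewrite E. ring.
Qed.

(** Time is read off the first and last angles, modulo the turns that each of them has
    made; [legendreF] gains four complete integrals per turn. *)
Lemma arc_time_value s phi0 phi1 (oma omb : R) (j i : Z) :
  0 < s < 1 -> 0 < phi0 < PI / 2 -> 0 < phi1 < PI / 2 ->
  sin phi0 ^ 2 < s -> sin phi1 ^ 2 < s ->
  PI / 2 < oma - 2 * IZR j * PI < PI -> sqrt s * cos oma = - sin phi0 ->
  0 < omb - 2 * IZR i * PI < PI / 2 -> sqrt s * cos omb = sin phi1 ->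
  legendreF s (PI / 2 - omb) - legendreF s (PI / 2 - oma) =
  4 * (IZR j - IZR i) * legendreK s + legendreF s (amplitude s phi0) + legendreF s (amplitude s phi1).
Proof.
  intros Hs H0 H1 Hs0 Hs1 Ha Ea Hb Eb.
  assert (Sm := sqrt_lt_R0 s ltac:(lra)).
  assert (A0 : oma - 2 * IZR j * PI - PI / 2 = amplitude s phi0).
  { unfold amplitude. rewrite <- (asin_sin (oma - 2 * IZR j * PI - PI / 2)) by lra.
    f_equal. destruct (period_Z (oma - 2 * IZR j * PI) j) as [_ Q].
    replace (oma - 2 * IZR j * PI + 2 * IZR j * PI) with oma in Q by ring.
    replace (oma - 2 * IZR j * PI - PI / 2)
      with (- (PI / 2 - (oma - 2 * IZR j * PI))) by ring.
    rewrite sin_neg, sin_shift, <- Q.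
    replace (sin phi0) with (- (sqrt s * cos oma)) by lra. field. lra. }
  assert (A1 : PI / 2 - (omb - 2 * IZR i * PI) = amplitude s phi1).
  { unfold amplitude. rewrite <- (asin_sin (PI / 2 - (omb - 2 * IZR i * PI))) by lra.
    f_equal. destruct (period_Z (omb - 2 * IZR i * PI) i) as [_ Q].
    replace (omb - 2 * IZR i * PI + 2 * IZR i * PI) with omb in Q by ring.
    rewrite sin_shift, <- Q.
    rewrite <- Eb. field. lra. }
  replace (PI / 2 - omb) with (amplitude s phi1 + 2 * IZR (- i) * PI)
    by (rewrite opp_IZR; lra).
  replace (PI / 2 - oma) with (- amplitude s phi0 + 2 * IZR (- j) * PI)
    by (rewrite opp_IZR; lra).
  rewrite !legendreF_turns by lra. rewrite legendreF_opp by lra. rewrite !opp_IZR. ring.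
Qed.

(** On an orbit of energy below [1] the abscissa cannot reach [PI / 2] in absolute value. *)
Lemma strip (x : R -> R) a s :
  s < 1 -> (forall t, continuous x t) -> (forall t, sin (x t) ^ 2 <= s) ->
  - (PI / 2) < x a < PI / 2 -> forall t, - (PI / 2) < x t < PI / 2.
Proof.
  intros Hs Cx Hsx Ha t.
  assert (Cx' : continuity x) by (intros u; apply continuity_pt_filterlim, Cx).
  split; apply Rnot_le_lt; intros Hle.
  - destruct (IVT_gen x a t (- (PI / 2)) Cx') as [u [_ Hu]].
    + split; [apply Rle_trans with (1 := Rmin_r _ _); lra|
              apply Rle_trans with (2 := Rmax_l _ _); lra].
    + specialize (Hsx u). rewrite Hu, sin_neg, sin_PI2 in Hsx. lra.
  - destruct (IVT_gen x a t (PI / 2) Cx') as [u [_ Hu]].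
    + split; [apply Rle_trans with (1 := Rmin_l _ _); lra|
              apply Rle_trans with (2 := Rmax_r _ _); lra].
    + specialize (Hsx u). rewrite Hu, sin_PI2 in Hsx. lra.
Qed.

Lemma sin_mul_pos x : - (PI / 2) < x < PI / 2 -> x <> 0 -> 0 < sin x * x.
Proof.
  intros H N. destruct (Rtotal_order x 0) as [L|[E|L]]; [|easy|].
  - assert (0 < sin (- x)) by (apply sin_gt_0; lra). rewrite sin_neg in H0. nra.
  - assert (0 < sin x) by (apply sin_gt_0; lra). nra.
Qed.

Lemma start_speed s phi0 y alpha : s = sin alpha ^ 2 -> 0 < y ->
  y ^ 2 - cos (2 * - phi0) = - cos (2 * alpha) ->
  y = sqrt 2 * sqrt (s - sin phi0 ^ 2).
Proof.
  intros -> Hy E. rewrite <- sqrt_mult_alt by lra.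
  rewrite <- (sqrt_pow2 y) by lra. f_equal.
  replace (2 * - phi0) with (- (2 * phi0)) in E by ring. rewrite cos_neg in E.
  rewrite !cos_2a_sin in E. lra.
Qed.

(** The angle [om] is the determination, nearest to the given polar angle of [(x, y)], of the
    angle of [(p, q) = (sin x / sqrt s, y / sqrt (2 s))]. It is close to the polar angle
    because the coordinates of both vectors have the same signs. *)
Lemma type_A_orbit_time phi0 phi1 k alpha L x y :
  0 < phi0 < phi1 -> phi1 < alpha < PI / 2 -> 0 < L ->
  type_A_orbit phi0 phi1 k alpha L x y ->
  2 * sqrt 2 * L = time_sum phi0 phi1 (4 * INR k) 1 (sin alpha ^ 2) /\
  y (- L) = sqrt 2 * sqrt (sin alpha ^ 2 - sin phi0 ^ 2).
Proof.
  intros Hphi Ha HL [[Cx [Cy [Hder [Hx0 Hx1]]]] [Hen [Hy0 [Hy1 Hturn]]]].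
  destruct Hturn as [th [Cth [Hth Hk]]].
  set (s := sin alpha ^ 2).
  assert (Hs1 : sin phi1 ^ 2 < s < 1) by (apply sin2_amplitude; lra).
  assert (Hs0 : sin phi0 ^ 2 < s) by (apply sin2_amplitude; lra).
  assert (Hs : 0 < s < 1) by (pose proof (sin2_bounds phi1); lra).
  assert (P := PI_RGT_0).
  assert (Hy0' : y (- L) = sqrt 2 * sqrt (s - sin phi0 ^ 2)).
  { apply (start_speed s phi0 _ alpha); [easy|easy|]. rewrite <- Hx0.
    apply Hen. lra. }
  split; [|easy].
  assert (Sm := sqrt_lt_R0 s ltac:(lra)). assert (Em := sqrt_sqrt s ltac:(lra)).
  assert (S2 := sqrt_lt_R0 2 ltac:(lra)). assert (E2 := sqrt_sqrt 2 ltac:(lra)).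
  set (c := clamp (- L) L).
  assert (Hc : forall t, - L <= c t <= L) by (intros t; apply clamp_in; lra).
  set (X := fun t => x (c t)). set (Y := fun t => y (c t)).
  set (TH := fun t => th (c t)).
  assert (CX : forall t, continuous X t) by (apply clamp_continuous; [lra|easy]).
  assert (CY : forall t, continuous Y t) by (apply clamp_continuous; [lra|easy]).
  assert (CTH : forall t, continuous TH t) by (apply clamp_continuous; [lra|easy]).
  assert (Ec0 : c (- L) = - L) by (apply clamp_id; lra).
  assert (Ec1 : c L = L) by (apply clamp_id; lra).
  (* on the energy level, (sin x, y / sqrt 2) lies on the circle of radius sqrt s *)
  assert (En : forall t, Y t ^ 2 = 2 * (s - sin (X t) ^ 2)).
  { intros t. specialize (Hen (c t) (Hc t)). fold (X t) (Y t) in Hen.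
    rewrite !cos_2a_sin in Hen. unfold s. lra. }
  assert (Hstrip : forall t, - (PI / 2) < X t < PI / 2).
  { apply (strip X (- L) s); [lra|easy| |].
    - intros t. specialize (En t). pose proof (pow2_ge_0 (Y t)). lra.
    - unfold X. rewrite Ec0, Hx0. lra. }
  set (p := fun t => / sqrt s * sin (X t)).
  set (q := fun t => / (sqrt 2 * sqrt s) * Y t).
  assert (Hpq : forall t, p t ^ 2 + q t ^ 2 = 1).
  { intros t. unfold p, q.
    replace ((/ sqrt s * sin (X t)) ^ 2 + (/ (sqrt 2 * sqrt s) * Y t) ^ 2)
      with (sin (X t) ^ 2 / (sqrt s * sqrt s) +
            Y t ^ 2 / ((sqrt 2 * sqrt 2) * (sqrt s * sqrt s))) by (field; lra).
    rewrite Em, E2, En. field. lra. }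
  assert (Hrho : forall t, 0 < X t ^ 2 + Y t ^ 2).
  { intros t. destruct (Req_dec (X t) 0) as [Z|N].
    - rewrite En, Z, sin_0. lra.
    - pose proof (pow2_gt_0 (X t) N). pose proof (pow2_ge_0 (Y t)). lra. }
  assert (HTH : forall t, is_angle (TH t) (X t) (Y t)) by (intros t; apply Hth, Hc).
  assert (Hdot : forall t, 0 < p t * cos (TH t) + q t * sin (TH t)).
  { intros t. destruct (HTH t) as [Q1 Q2]. specialize (Hrho t).
    assert (Sr := sqrt_lt_R0 _ Hrho). set (rho := sqrt (X t ^ 2 + Y t ^ 2)) in *.
    apply (Rmult_lt_reg_l rho); [easy|]. rewrite Rmult_0_r.
    replace (rho * (p t * cos (TH t) + q t * sin (TH t)))
      with (p t * (rho * cos (TH t)) + q t * (rho * sin (TH t))) by ring.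
    rewrite <- Q1, <- Q2. unfold p, q.
    assert (I1 : 0 < / sqrt s) by now apply Rinv_0_lt_compat.
    assert (I2 : 0 < / (sqrt 2 * sqrt s)) by (apply Rinv_0_lt_compat; nra).
    assert (0 <= / (sqrt 2 * sqrt s) * Y t * Y t).
    { pose proof (pow2_ge_0 (Y t)). nra. }
    destruct (Req_dec (X t) 0) as [Z|N].
    - assert (0 < Y t ^ 2) by (rewrite En, Z, sin_0; lra).
      assert (0 < / (sqrt 2 * sqrt s) * Y t * Y t) by nra.
      rewrite Z. lra.
    - pose proof (sin_mul_pos (X t) (Hstrip t) N).
      assert (0 < / sqrt s * sin (X t) * X t) by (rewrite Rmult_assoc; nra). lra. }
  set (om := fun t => lift (TH t) (p t) (q t)).
  assert (Hom : forall t, cos (om t) = p t /\ sin (om t) = q t /\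
                  Rabs (om t - TH t) < PI / 2).
  { intros t. destruct (lift_is_angle (TH t) (p t) (q t) (Hdot t)) as [[Q1 Q2] Q3].
    rewrite Hpq, sqrt_1, Rmult_1_l in Q1, Q2. now repeat split. }
  assert (Cp : forall t, continuous p t).
  { intros t. apply (continuous_scal_r (V := R_NormedModule) (/ sqrt s)
      (fun t => sin (X t))).
    apply (continuous_comp X sin); [apply CX|apply continuous_sin]. }
  assert (Cq : forall t, continuous q t).
  { intros t. apply (continuous_scal_r (V := R_NormedModule)
      (/ (sqrt 2 * sqrt s)) Y). apply CY. }
  assert (Com : forall t, continuous om t).
  { intros t. apply lift_continuous; [apply CTH|apply Cp|apply Cq|apply Hdot]. }
  assert (Time : legendreF s (PI / 2 - om L) - legendreF s (PI / 2 - om (- L)) =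
                 sqrt 2 * (2 * L)).
  { apply (pendulum_arc_time s L X Y om); [easy|easy|easy| |].
    - intros t. destruct (Hom t) as [Q1 [Q2 _]]. rewrite Q1, Q2. unfold p, q.
      repeat split; try (field; lra). apply cos_gt_0; apply Hstrip.
    - intros t Ht. destruct (Hder t Ht) as [D1 D2].
      unfold X at 2, Y at 1. unfold c. rewrite clamp_id by lra.
      split; apply clamp_derive; easy. }
  (* the angle of (x, y) and that of (p, q) make the same number of turns *)
  assert (X0 : X (- L) = - phi0) by (unfold X; now rewrite Ec0).
  assert (X1 : X L = phi1) by (unfold X; now rewrite Ec1).
  assert (Y0 : 0 < Y (- L)) by (unfold Y; now rewrite Ec0).
  assert (Y1 : 0 < Y L) by (unfold Y; now rewrite Ec1).
  assert (Sp0 := sin_pos_quarter phi0 ltac:(lra)).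
  assert (Sp1 := sin_pos_quarter phi1 ltac:(lra)).
  assert (I1 : 0 < / sqrt s) by now apply Rinv_0_lt_compat.
  assert (I2 : 0 < / (sqrt 2 * sqrt s)) by (apply Rinv_0_lt_compat; nra).
  destruct (Hom (- L)) as [Oc0 [Os0 On0]]. destruct (Hom L) as [Oc1 [Os1 On1]].
  destruct (is_angle_signs _ _ _ (HTH (- L)) (Hrho (- L))) as [_ [T0c T0s]].
  destruct (is_angle_signs _ _ _ (HTH L) (Hrho L)) as [T1c [_ T1s]].
  destruct (second_quadrant_near (TH (- L)) (om (- L))) as [j [J1 J2]].
  { apply T0c. lra. }
  { now apply T0s. }
  { rewrite Oc0. unfold p. rewrite X0, sin_neg. nra. }
  { rewrite Os0. unfold q. nra. }
  { now rewrite Rabs_minus_sym. }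
  destruct (first_quadrant_near (TH L) (om L)) as [i [K1 K2]].
  { apply T1c. lra. }
  { now apply T1s. }
  { rewrite Oc1. unfold p. rewrite X1. nra. }
  { rewrite Os1. unfold q. nra. }
  { now rewrite Rabs_minus_sym. }
  assert (Ejk : IZR j - IZR i = INR k).
  { unfold TH in J1, K1. rewrite Ec0 in J1. rewrite Ec1 in K1.
    rewrite INR_IZR_INZ in *.
    assert (D1 : 2 * PI * (IZR (Z.of_nat k) - (IZR j - IZR i)) < PI) by lra.
    assert (D2 : - (2 * PI) < 2 * PI * (IZR (Z.of_nat k) - (IZR j - IZR i))) by lra.
    assert (Q : Z.of_nat k = (j - i)%Z).
    { apply IZR_close. rewrite minus_IZR. split; nra. }
    rewrite Q, minus_IZR. ring. }
  rewrite (arc_time_value s phi0 phi1 (om (- L)) (om L) j i) in Time; try lra.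
  - unfold time_sum. rewrite !transit_legendreF by lra.
    fold (amplitude s phi0) (amplitude s phi1).
    rewrite Ejk in Time. lra.
  - rewrite Oc0. unfold p. rewrite X0, sin_neg. field. lra.
  - rewrite Oc1. unfold p. rewrite X1. field. lra.
Qed.

(** With [psi] the amplitude of the elapsed time, [sin x = sqrt s * sin psi] and
    [y = sqrt (2 s) * cos psi] define the orbit, and the angle [PI / 2 - psi] serves to
    construct its polar angle. *)
Lemma type_A_orbit_exists phi0 phi1 k alpha L :
  0 < phi0 < phi1 -> phi1 < alpha < PI / 2 ->
  2 * sqrt 2 * L = time_sum phi0 phi1 (4 * INR k) 1 (sin alpha ^ 2) ->
  exists x y, 0 < L /\ type_A_orbit phi0 phi1 k alpha L x y.
Proof.
  intros Hphi Ha EL. set (s := sin alpha ^ 2) in *.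
  assert (Hs1 : sin phi1 ^ 2 < s < 1) by (apply sin2_amplitude; lra).
  assert (Hs0 : sin phi0 ^ 2 < s) by (apply sin2_amplitude; lra).
  assert (Hs : 0 < s < 1) by (pose proof (sin2_bounds phi1); lra).
  assert (P := PI_RGT_0).
  assert (Sm := sqrt_lt_R0 s ltac:(lra)). assert (Em := sqrt_sqrt s ltac:(lra)).
  assert (S2 := sqrt_lt_R0 2 ltac:(lra)). assert (E2 := sqrt_sqrt 2 ltac:(lra)).
  destruct (amplitude_spec s phi0 ltac:(lra) Hs0) as [A0 A0s].
  destruct (amplitude_spec s phi1 ltac:(lra) ltac:(lra)) as [A1 A1s].
  assert (Cos : forall z, 0 < z < PI / 2 -> 0 < cos z) by (intros; apply cos_gt_0; lra).
  assert (Kp := legendreK_pos s ltac:(lra)).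
  assert (Kk := pos_INR k).
  assert (HL : 0 < L).
  { unfold time_sum in EL.
    assert (I1 := transit_pos s 0 phi0 ltac:(lra) ltac:(lra) ltac:(lra)).
    assert (I2 := transit_pos s 0 phi1 ltac:(lra) ltac:(lra) ltac:(lra)).
    assert (0 <= INR k * legendreK s) by nra.
    assert (0 < 2 * sqrt 2 * L) by lra. nra. }
  destruct (legendreF_inverse s ltac:(lra)) as [am [Eam Dam]].
  set (m := sqrt s) in *. set (r2 := sqrt 2) in *.
  set (psi := fun t => am (r2 * (t + L) - legendreF s (amplitude s phi0))).
  assert (Inj : forall u z, legendreF s z = u -> am u = z).
  { intros u z E. destruct (Rtotal_order (am u) z) as [Q|[Q|Q]]; [exfalso|easy|exfalso].
    - assert (Q' := legendreF_lt s (am u) z ltac:(lra) Q). rewrite Eam in Q'. lra.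
    - assert (Q' := legendreF_lt s z (am u) ltac:(lra) Q). rewrite Eam in Q'. lra. }
  assert (Psi0 : psi (- L) = - amplitude s phi0).
  { apply Inj. rewrite legendreF_opp by lra. ring. }
  assert (Psi1 : psi L = amplitude s phi1 + 2 * INR k * PI).
  { apply Inj. rewrite legendreF_turns_nat by lra. unfold time_sum in EL.
    rewrite !transit_legendreF in EL by lra. fold (amplitude s phi0) (amplitude s phi1) in EL.
    lra. }
  set (De := fun z => sqrt (1 - s * sin z ^ 2)).
  assert (HDe : forall z, 0 < De z).
  { intros z. apply sqrt_lt_R0, legendreF_radicand_pos. lra. }
  assert (Dpsi : forall t, is_derive psi t (r2 * De (psi t))).
  { intros t.
    apply (is_derive_comp am (fun t => r2 * (t + L) - legendreF s (amplitude s phi0))).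
    - apply Dam.
    - auto_derive; [easy|ring]. }
  assert (Bm : forall z, -1 < m * sin z < 1).
  { intros z. pose proof (SIN_bound z). assert (m < 1) by nra. split; nra. }
  set (x := fun t => asin (m * sin (psi t))).
  set (y := fun t => r2 * m * cos (psi t)).
  assert (Sx : forall t, sin (x t) = m * sin (psi t)).
  { intros t. apply sin_asin. specialize (Bm (psi t)). lra. }
  assert (Cx : forall t, cos (x t) = De (psi t)).
  { intros t. unfold x. rewrite cos_asin by (specialize (Bm (psi t)); lra).
    unfold De. f_equal. unfold Rsqr. rewrite <- Em. ring. }
  assert (Dx : forall t, is_derive x t (y t)).
  { intros t. unfold x.
    replace (y t) with (scal (m * (r2 * De (psi t) * cos (psi t)))
                          (1 / sqrt (1 - (m * sin (psi t))²))).
    - apply (is_derive_comp asin (fun t => m * sin (psi t))).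
      + apply is_derive_Reals. rewrite <- (derive_pt_asin _ (Bm (psi t))).
        apply (derive_pt_eq_1 _ _ _ (derivable_pt_asin _ (Bm (psi t)))). reflexivity.
      + apply is_derive_scal. apply (is_derive_comp sin psi); [|apply Dpsi].
        apply is_derive_sin.
    - replace (1 - (m * sin (psi t))²) with (1 - s * sin (psi t) ^ 2)
        by (unfold Rsqr; rewrite <- Em; ring).
      fold (De (psi t)). unfold scal; simpl; unfold mult; simpl. unfold y.
      specialize (HDe (psi t)). field. lra. }
  assert (Dy : forall t, is_derive y t (- sin (2 * x t))).
  { intros t. rewrite sin_2a, Sx, Cx. unfold y.
    replace (- (2 * (m * sin (psi t)) * De (psi t)))
      with (r2 * m * (r2 * De (psi t) * - sin (psi t))).
    - apply is_derive_scal. apply (is_derive_comp cos psi); [|apply Dpsi].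
      apply is_derive_cos.
    - replace (r2 * m * (r2 * De (psi t) * - sin (psi t)))
        with (- (r2 * r2 * (m * sin (psi t)) * De (psi t))) by ring.
      rewrite E2. ring. }
  assert (Cpsi : forall t, continuous psi t).
  { intros t. apply (ex_derive_continuous psi). eexists. apply Dpsi. }
  assert (Cxt : forall t, continuous x t).
  { intros t. apply (ex_derive_continuous x). eexists. apply Dx. }
  assert (Cyt : forall t, continuous y t).
  { intros t. apply (ex_derive_continuous y). eexists. apply Dy. }
  assert (Bx : forall t, - (PI / 2) < x t < PI / 2).
  { intros t. apply asin_bound_lt, Bm. }
  assert (X0 : x (- L) = - phi0).
  { unfold x. rewrite Psi0, sin_neg.
    replace (m * - sin (amplitude s phi0)) with (sin (- phi0)) by (rewrite sin_neg; lra).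
    apply asin_sin. lra. }
  assert (X1 : x L = phi1).
  { unfold x. rewrite Psi1, sin_period, A1s. apply asin_sin. lra. }
  assert (Y0 : 0 < y (- L)).
  { unfold y. rewrite Psi0, cos_neg. specialize (Cos _ A0).
    repeat apply Rmult_lt_0_compat; lra. }
  assert (Y1 : 0 < y L).
  { unfold y. rewrite Psi1, cos_period. specialize (Cos _ A1).
    repeat apply Rmult_lt_0_compat; lra. }
  set (eta := fun t => PI / 2 - psi t).
  assert (Hdot : forall t, 0 < x t * cos (eta t) + y t * sin (eta t)).
  { intros t. unfold eta. rewrite cos_shift, sin_shift.
    assert (Hy : y t * cos (psi t) = r2 * m * (cos (psi t) * cos (psi t)))
      by (unfold y; ring).
    pose proof (sin2_cos2 (psi t)) as T1. unfold Rsqr in T1.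
    destruct (Req_dec (x t) 0) as [Z|N].
    - specialize (Sx t). rewrite Z, sin_0 in Sx.
      assert (sin (psi t) = 0) by nra. rewrite H in T1.
      rewrite Hy, Z. replace (cos (psi t) * cos (psi t)) with 1 by lra. nra.
    - assert (Q := sin_mul_pos (x t) (Bx t) N). rewrite Sx in Q.
      assert (0 < x t * sin (psi t)) by nra.
      assert (0 <= cos (psi t) * cos (psi t)) by apply Rle_0_sqr.
      assert (0 <= r2 * m * (cos (psi t) * cos (psi t))).
      { apply Rmult_le_pos; [nra|easy]. }
      lra. }
  exists x, y. split; [easy|].
  split; [|split; [|split; [easy|split; [easy|]]]].
  - split; [|split; [|split; [|easy]]].
    + apply continuous_on_forall. intros t _. apply Cxt.
    + apply continuous_on_forall. intros t _. apply Cyt.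
    + intros t _. split; [apply Dx|apply Dy].
  - intros t _. rewrite !cos_2a_sin, Sx. unfold y.
    pose proof (sin2_cos2 (psi t)) as T1. unfold Rsqr in T1.
    replace ((r2 * m * cos (psi t)) ^ 2)
      with ((r2 * r2) * (m * m) * (cos (psi t) * cos (psi t))) by ring.
    replace (2 * (m * sin (psi t)) * (m * sin (psi t)))
      with (2 * (m * m) * (sin (psi t) * sin (psi t))) by ring.
    rewrite E2, Em.
    replace (cos (psi t) * cos (psi t)) with (1 - sin (psi t) * sin (psi t)) by lra.
    unfold s. ring.
  - set (th := fun t => lift (eta t) (x t) (y t)).
    assert (Hth : forall t, is_angle (th t) (x t) (y t) /\
                    Rabs (th t - eta t) < PI / 2).
    { intros t. apply lift_is_angle, Hdot. }
    exists th. split; [|split].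
    + apply continuous_on_forall. intros t _. apply lift_continuous; try easy.
      apply (continuous_minus (V := R_NormedModule) (fun _ => PI / 2) psi);
      [apply continuous_const|apply Cpsi].
    + intros t _. apply Hth.
    + assert (Hrho : forall t, 0 < y t -> 0 < x t ^ 2 + y t ^ 2).
      { intros t Hy. pose proof (pow2_ge_0 (x t)). nra. }
      destruct (Hth (- L)) as [Q0 N0]. destruct (Hth L) as [Q1 N1].
      destruct (is_angle_signs _ _ _ Q0 (Hrho _ Y0)) as [_ [T0c T0s]].
      destruct (is_angle_signs _ _ _ Q1 (Hrho _ Y1)) as [T1c [_ T1s]].
      destruct (second_quadrant_near (th (- L)) (eta (- L))) as [j [J1 J2]].
      { apply T0c. lra. }
      { now apply T0s. }
      { unfold eta. rewrite Psi0, cos_shift, sin_neg.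
        assert (0 < sin (amplitude s phi0)) by (apply sin_gt_0; lra). lra. }
      { unfold eta. rewrite Psi0, sin_shift, cos_neg. now apply Cos. }
      { easy. }
      destruct (first_quadrant_near (th L) (eta L)) as [i [K1 K2]].
      { apply T1c. lra. }
      { now apply T1s. }
      { unfold eta. rewrite Psi1, cos_shift, sin_period. apply sin_gt_0; lra. }
      { unfold eta. rewrite Psi1, sin_shift, cos_period. now apply Cos. }
      { easy. }
      unfold eta in J2, K2. rewrite Psi0 in J2. rewrite Psi1 in K2.
      assert (Ej : j = 0%Z).
      { apply IZR_close. split; nra. }
      assert (Ei : i = (- Z.of_nat k)%Z).
      { apply IZR_close. rewrite opp_IZR, <- INR_IZR_INZ. split; nra. }
      subst j i. rewrite opp_IZR, <- INR_IZR_INZ in K1. split; nra.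
Qed.

(** * The times and the branch of type A *)

Lemma T_A_time_sum phi0 phi1 k alpha :
  0 < phi0 < phi1 -> phi1 < alpha < PI / 2 ->
  T_A phi0 phi1 k alpha = / sqrt 2 * time_sum phi0 phi1 (4 * INR k) 1 (sin alpha ^ 2).
Proof.
  intros Hphi Ha. unfold T_A, time_sum. rewrite T_legendreK, !T1_transit by lra. ring.
Qed.

Lemma T_Cl_time_sum phi0 phi1 k alpha :
  0 < phi0 < phi1 -> phi1 < alpha < PI / 2 ->
  T_Cl phi0 phi1 k alpha =
  / sqrt 2 * time_sum phi0 phi1 (4 * INR k + 2) (-1) (sin alpha ^ 2).
Proof.
  intros Hphi Ha. unfold T_Cl, time_sum. rewrite T_legendreK, !T1_transit by lra. ring.
Qed.

Lemma T_lower_star_limit phi0 phi1 k :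
  0 < phi0 < phi1 -> phi1 < PI / 2 ->
  T_lower_star phi0 phi1 k = / sqrt 2 * time_sum_limit phi0 phi1 (4 * INR k) 1.
Proof.
  intros Hphi H1. unfold T_lower_star, time_sum_limit.
  rewrite T_legendreK, T1_transit by lra. ring.
Qed.

Lemma T_upper_star_limit phi0 phi1 k :
  0 < phi0 < phi1 -> phi1 < PI / 2 ->
  T_upper_star phi0 phi1 k = / sqrt 2 * time_sum_limit phi0 phi1 (4 * INR k + 2) (-1).
Proof.
  intros Hphi H1. unfold T_upper_star, time_sum_limit.
  rewrite T_legendreK, T1_transit by lra. ring.
Qed.

Lemma T1_T_bounds phi0 phi1 :
  0 < phi0 < phi1 -> phi1 < PI / 2 -> 0 < T1 phi1 phi0 < T phi1.
Proof.
  intros Hphi H1. rewrite T_legendreK, T1_transit by lra.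
  assert (S2 := Rinv_0_lt_compat _ (sqrt_lt_R0 2 ltac:(lra))).
  assert (Q : sin phi0 ^ 2 < sin phi1 ^ 2 < 1) by (apply sin2_amplitude; lra).
  pose proof (transit_pos (sin phi1 ^ 2) 0 phi0 ltac:(lra) ltac:(lra) ltac:(lra)).
  pose proof (transit_lt_legendreK (sin phi1 ^ 2) phi0 ltac:(lra) Q).
  split; [now apply Rmult_lt_0_compat|now apply Rmult_lt_compat_l].
Qed.

(** Compared with its value at the turning point [alpha = phi1], the complete integral
    has increased and the transit from [phi0] to [phi1], which is subtracted, has
    decreased. *)
Lemma T_Cr_lower phi0 phi1 k alpha :
  0 < phi0 < phi1 -> phi1 < alpha < PI / 2 ->
  T_lower_star phi0 phi1 k < T_Cr phi0 phi1 k alpha.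
Proof.
  intros Hphi Ha. unfold T_lower_star, T_Cr. rewrite !T_legendreK, !T1_transit by lra.
  assert (S2 := Rinv_0_lt_compat _ (sqrt_lt_R0 2 ltac:(lra))).
  assert (Q : sin phi1 ^ 2 < sin alpha ^ 2 < 1) by (apply sin2_amplitude; lra).
  assert (Q0 : sin phi0 ^ 2 < sin phi1 ^ 2) by (apply sin2_lt; lra).
  pose proof (sin2_bounds phi1).
  assert (HK := legendreK_lt (sin phi1 ^ 2) (sin alpha ^ 2) ltac:(lra) ltac:(lra) ltac:(lra)).
  assert (HI := transit_le_legendreK phi1 (sin alpha ^ 2) phi0 ltac:(lra) ltac:(lra) Q).
  assert (HC := transit_Chasles (sin alpha ^ 2) phi0 phi1
    ltac:(lra) ltac:(lra) ltac:(lra)).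
  pose proof (pos_INR k).
  set (K1 := legendreK (sin phi1 ^ 2)) in *. set (K2 := legendreK (sin alpha ^ 2)) in *.
  set (r := / sqrt 2) in *.
  apply Rlt_0_minus.
  match goal with |- 0 < ?e => replace e with
    (r * ((4 * INR k + 2) * (K2 - K1) + (K1 - transit (sin phi1 ^ 2) 0 phi0 -
      (transit (sin alpha ^ 2) 0 phi1 - transit (sin alpha ^ 2) 0 phi0)))) by ring end.
  apply Rmult_lt_0_compat; [easy|]. nra.
Qed.

Lemma T_D_lower phi0 phi1 k alpha :
  0 < phi0 < phi1 -> phi1 < alpha < PI / 2 ->
  T_upper_star phi0 phi1 k < T_D phi0 phi1 k alpha.
Proof.
  intros Hphi Ha. unfold T_upper_star, T_D. rewrite !T_legendreK, !T1_transit by lra.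
  assert (S2 := Rinv_0_lt_compat _ (sqrt_lt_R0 2 ltac:(lra))).
  assert (Q : sin phi1 ^ 2 < sin alpha ^ 2 < 1) by (apply sin2_amplitude; lra).
  assert (Q0 : sin phi0 ^ 2 < sin phi1 ^ 2) by (apply sin2_lt; lra).
  pose proof (sin2_bounds phi1).
  assert (HK := legendreK_lt (sin phi1 ^ 2) (sin alpha ^ 2) ltac:(lra) ltac:(lra) ltac:(lra)).
  assert (HI := transit_le_legendreK phi1 (sin alpha ^ 2) phi0 ltac:(lra) ltac:(lra) Q).
  assert (HC := transit_Chasles (sin alpha ^ 2) phi0 phi1
    ltac:(lra) ltac:(lra) ltac:(lra)).
  assert (HJ := transit_lt (sin phi1 ^ 2) (sin alpha ^ 2) 0 phi0
    ltac:(lra) ltac:(lra) Q0 ltac:(lra)).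
  pose proof (pos_INR k).
  set (K1 := legendreK (sin phi1 ^ 2)) in *. set (K2 := legendreK (sin alpha ^ 2)) in *.
  set (r := / sqrt 2) in *.
  apply Rlt_0_minus.
  match goal with |- 0 < ?e => replace e with
    (r * (4 * (INR k + 1) * (K2 - K1) + (K1 + transit (sin phi1 ^ 2) 0 phi0 -
      transit (sin alpha ^ 2) 0 phi1 - transit (sin alpha ^ 2) 0 phi0))) by ring end.
  apply Rmult_lt_0_compat; [easy|]. nra.
Qed.

(** Half the time of a type A orbit as a function of its initial speed [y], for which
    [s = sin^2 phi0 + y^2 / 2]. *)
Definition half_time (phi0 phi1 : R) (k : nat) (y : R) : R :=
  / (2 * sqrt 2) *
  time_sum phi0 phi1 (4 * INR k) 1 (sin phi0 ^ 2 + (/ sqrt 2 * y) ^ 2).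

Definition speed_inf (phi0 phi1 : R) : R :=
  sqrt 2 * sqrt (sin phi1 ^ 2 - sin phi0 ^ 2).

Definition speed_sup (phi0 : R) : R := sqrt 2 * sqrt (1 - sin phi0 ^ 2).

Lemma speed_modulus phi0 phi1 y :
  0 < phi0 < phi1 -> phi1 < PI / 2 ->
  speed_inf phi0 phi1 < y < speed_sup phi0 ->
  0 < y /\ sin phi1 ^ 2 < sin phi0 ^ 2 + (/ sqrt 2 * y) ^ 2 < 1.
Proof.
  intros Hphi H1 Hy. unfold speed_inf, speed_sup in Hy.
  assert (Q : sin phi0 ^ 2 < sin phi1 ^ 2 < 1) by (apply sin2_amplitude; lra).
  assert (S2 := sqrt_lt_R0 2 ltac:(lra)).
  assert (Sa := sqrt_lt_R0 (sin phi1 ^ 2 - sin phi0 ^ 2) ltac:(lra)).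
  assert (Ea := sqrt_sqrt (sin phi1 ^ 2 - sin phi0 ^ 2) ltac:(lra)).
  assert (Eb := sqrt_sqrt (1 - sin phi0 ^ 2) ltac:(lra)).
  set (a := sqrt (sin phi1 ^ 2 - sin phi0 ^ 2)) in *.
  set (b := sqrt (1 - sin phi0 ^ 2)) in *.
  assert (Ew : sqrt 2 * (/ sqrt 2 * y) = y) by (field; lra).
  set (w := / sqrt 2 * y) in *.
  assert (a < w) by (apply (Rmult_lt_reg_l (sqrt 2)); lra).
  assert (w < b) by (apply (Rmult_lt_reg_l (sqrt 2)); lra).
  split; [nra|split; nra].
Qed.

Lemma type_A_branch_graph phi0 phi1 k L y :
  0 < phi0 < phi1 -> phi1 < PI / 2 ->
  type_A_branch phi0 phi1 k (L, y) <->
  speed_inf phi0 phi1 < y < speed_sup phi0 /\ L = half_time phi0 phi1 k y.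
Proof.
  intros Hphi H1. assert (S2 := sqrt_lt_R0 2 ltac:(lra)).
  split.
  - intros [alpha [X [Y [Ha [HL [Horb Hy]]]]]]. cbn [fst snd] in *.
    destruct (type_A_orbit_time phi0 phi1 k alpha L X Y Hphi Ha HL Horb) as [ET Ey].
    rewrite <- Hy in Ey.
    assert (Q : sin phi1 ^ 2 < sin alpha ^ 2 < 1) by (apply sin2_amplitude; lra).
    assert (Q0 : sin phi0 ^ 2 < sin phi1 ^ 2) by (apply sin2_lt; lra).
    split.
    + rewrite Ey. unfold speed_inf, speed_sup.
      split; (apply Rmult_lt_compat_l; [easy|apply sqrt_lt_1; lra]).
    + unfold half_time. rewrite Ey, <- Rmult_assoc, Rinv_l, Rmult_1_l, pow2_sqrt by lra.
      replace (sin phi0 ^ 2 + (sin alpha ^ 2 - sin phi0 ^ 2)) with (sin alpha ^ 2)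
        by ring.
      rewrite <- ET. field. lra.
  - intros [Hy ->].
    destruct (speed_modulus phi0 phi1 y Hphi H1 Hy) as [Hy0 Hs].
    set (s := sin phi0 ^ 2 + (/ sqrt 2 * y) ^ 2) in *.
    destruct (asin_sqrt_amplitude phi1 s ltac:(lra) Hs) as [Ha Es].
    set (alpha := asin (sqrt s)) in *.
    destruct (type_A_orbit_exists phi0 phi1 k alpha (half_time phi0 phi1 k y) Hphi Ha)
      as [X [Y [HL Horb]]].
    { rewrite Es. unfold half_time. fold s. field. lra. }
    exists alpha, X, Y. cbn [fst snd].
    split; [easy|split; [easy|split; [easy|]]].
    destruct (type_A_orbit_time _ _ _ _ _ _ _ Hphi Ha HL Horb) as [_ Ey].
    rewrite Ey, Es. unfold s.
    replace (sin phi0 ^ 2 + (/ sqrt 2 * y) ^ 2 - sin phi0 ^ 2)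
      with ((/ sqrt 2 * y) ^ 2) by ring.
    rewrite sqrt_pow2; [field; lra|].
    apply Rlt_le, Rmult_lt_0_compat; [now apply Rinv_0_lt_compat|easy].
Qed.

Lemma half_time_convex phi0 phi1 k :
  0 < phi0 < phi1 -> phi1 < PI / 2 -> (1 <= k)%nat ->
  convex_on (speed_inf phi0 phi1) (speed_sup phi0) (half_time phi0 phi1 k).
Proof.
  intros Hphi H1 Hk x y t Hx Hy Ht.
  assert (S2 := sqrt_lt_R0 2 ltac:(lra)).
  assert (Hk' : 4 <= 4 * INR k) by (apply le_INR in Hk; simpl in Hk; lra).
  assert (In : forall z, speed_inf phi0 phi1 < z < speed_sup phi0 ->
    sqrt (sin phi1 ^ 2 - sin phi0 ^ 2) < / sqrt 2 * z < sqrt (1 - sin phi0 ^ 2)).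
  { intros z [Hz1 Hz2]. unfold speed_inf, speed_sup in *.
    assert (E : sqrt 2 * (/ sqrt 2 * z) = z) by (field; lra).
    split; apply (Rmult_lt_reg_l (sqrt 2)); lra. }
  assert (C := total_time_convex_in_speed phi0 phi1 (4 * INR k) Hphi H1 Hk'
    (/ sqrt 2 * x) (/ sqrt 2 * y) t (In x Hx) (In y Hy) Ht).
  cbv beta in C. unfold half_time, time_sum.
  replace (/ sqrt 2 * (t * x + (1 - t) * y))
    with (t * (/ sqrt 2 * x) + (1 - t) * (/ sqrt 2 * y)) by ring.
  assert (r : 0 < / (2 * sqrt 2)) by (apply Rinv_0_lt_compat; lra).
  apply (Rmult_le_compat_l (/ (2 * sqrt 2))) in C; [|lra].
  match type of C with ?u <= ?v => apply Rle_trans with u; [apply Req_le; ring|];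
    apply Rle_trans with v; [exact C|apply Req_le; ring] end.
Qed.

Lemma half_time_valley phi0 phi1 k :
  0 < phi0 < phi1 -> phi1 < PI / 2 -> (1 <= k)%nat ->
  exists y, valley (speed_inf phi0 phi1) (speed_sup phi0) (half_time phi0 phi1 k) y.
Proof.
  intros Hphi H1 Hk.
  assert (S2 := sqrt_lt_R0 2 ltac:(lra)).
  assert (Hc : 0 < 4 * INR k) by (apply le_INR in Hk; simpl in Hk; lra).
  destruct (time_sum_valley phi0 phi1 (4 * INR k) 1 Hphi H1 Hc ltac:(lra)) as [s V].
  { now apply time_sum_plus_strict_convex. }
  assert (Hs := proj1 V).
  assert (Q : sin phi0 ^ 2 < sin phi1 ^ 2) by (apply sin2_lt; lra).
  exists (sqrt 2 * sqrt (s - sin phi0 ^ 2)).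
  apply (valley_transport (sin phi1 ^ 2) 1 _ _ (time_sum phi0 phi1 (4 * INR k) 1)
    (fun y => sin phi0 ^ 2 + (/ sqrt 2 * y) ^ 2) _ (/ (2 * sqrt 2)) _ s); try easy.
  - apply Rinv_0_lt_compat; lra.
  - unfold speed_inf, speed_sup.
    split; (apply Rmult_lt_compat_l; [easy|apply sqrt_lt_1; lra]).
  - rewrite <- Rmult_assoc, Rinv_l, Rmult_1_l, pow2_sqrt by lra. ring.
  - intros y Hy. now apply speed_modulus.
  - intros x y Hx Hxy Hy.
    destruct (speed_modulus phi0 phi1 x Hphi H1 ltac:(lra)) as [Hx0 _].
    assert (I := Rinv_0_lt_compat _ S2).
    assert (0 < / sqrt 2 * x) by now apply Rmult_lt_0_compat.
    assert (/ sqrt 2 * x < / sqrt 2 * y) by now apply Rmult_lt_compat_l.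
    nra.
Qed.

Lemma T_Cl_valley phi0 phi1 k :
  0 < phi0 < phi1 -> phi1 < PI / 2 ->
  exists alpha, valley phi1 (PI / 2) (T_Cl phi0 phi1 k) alpha.
Proof.
  intros Hphi H1.
  assert (Hc : 0 < 4 * INR k + 2) by (pose proof (pos_INR k); lra).
  destruct (time_sum_valley phi0 phi1 (4 * INR k + 2) (-1) Hphi H1 Hc ltac:(lra))
    as [s V].
  { now apply time_sum_minus_strict_convex. }
  destruct (asin_sqrt_amplitude phi1 s ltac:(lra) (proj1 V)) as [Ha Es].
  exists (asin (sqrt s)).
  apply (valley_transport (sin phi1 ^ 2) 1 _ _
    (time_sum phi0 phi1 (4 * INR k + 2) (-1))
    (fun alpha => sin alpha ^ 2) _ (/ sqrt 2) _ s); try easy.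
  - apply Rinv_0_lt_compat, sqrt_lt_R0. lra.
  - intros a Ha'. apply sin2_amplitude; lra.
  - intros a a' H2 H3 H4. apply sin2_lt; lra.
  - intros a Ha'. now apply T_Cl_time_sum.
Qed.

Lemma T_Cl_convex phi0 phi1 k :
  0 < phi0 < phi1 -> phi1 < PI / 2 ->
  convex_on (sin phi1 ^ 2) 1 (fun s => T_Cl phi0 phi1 k (asin (sqrt s))).
Proof.
  intros Hphi H1.
  assert (Hc : 0 < 4 * INR k + 2) by (pose proof (pos_INR k); lra).
  apply strict_convex_on_convex_on.
  apply (strict_convex_on_ext _ _
    (fun s => / sqrt 2 * time_sum phi0 phi1 (4 * INR k + 2) (-1) s)).
  - intros s Hs.
    destruct (asin_sqrt_amplitude phi1 s ltac:(lra) Hs) as [Ha Es].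
    rewrite T_Cl_time_sum, Es by lra. reflexivity.
  - apply strict_convex_on_scal.
    + apply Rinv_0_lt_compat, sqrt_lt_R0. lra.
    + now apply time_sum_minus_strict_convex.
Qed.

Lemma dip_at_right phi0 phi1 c sg (f : R -> R) V :
  0 < phi0 < phi1 -> phi1 < PI / 2 -> 0 < c -> -1 <= sg <= 1 ->
  (forall alpha, phi1 < alpha < PI / 2 ->
     f alpha = / sqrt 2 * time_sum phi0 phi1 c sg (sin alpha ^ 2)) ->
  V = / sqrt 2 * time_sum_limit phi0 phi1 c sg ->
  at_right phi1 (fun alpha => f alpha < V).
Proof.
  intros Hphi H1 Hc Hsg Hf ->.
  destruct (time_sum_dip phi0 phi1 c sg Hphi H1 Hc Hsg) as [d [Hd [_ Hdip]]].
  apply (at_right_amplitude phi1 d _ _ ltac:(lra) Hd Hdip).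
  intros alpha Ha Hlt. rewrite Hf by easy.
  apply Rmult_lt_compat_l; [|easy]. apply Rinv_0_lt_compat, sqrt_lt_R0. lra.
Qed.

Theorem mainTheorem5 (phi0 phi1 : R) (k : nat)
    (hphi0 : 0 < phi0) (hphi01 : phi0 < phi1) (hphi1 : phi1 < PI / 2)
    (hk : (1 <= k)%nat) :
  (* (a) *)
  T_upper_star phi0 phi1 k < T_lower_star phi0 phi1 (k + 1) /\
  (* (b) *)
  T_lower_star phi0 phi1 k < T_upper_star phi0 phi1 k /\
  (* (c) *)
  (forall alpha, phi1 < alpha < PI / 2 ->
     T_lower_star phi0 phi1 k < T_Cr phi0 phi1 k alpha /\
     T_upper_star phi0 phi1 k < T_D phi0 phi1 k alpha) /\
  (* (d) *)
  (convex_on (sin phi1 ^ 2) 1 (fun s => T_Cl phi0 phi1 k (asin (sqrt s))) /\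
   filterlim (T_Cl phi0 phi1 k) (at_left (PI / 2)) (Rbar_locally p_infty) /\
   (exists alpha0, phi1 < alpha0 < PI / 2 /\
      local_min (T_Cl phi0 phi1 k) alpha0 /\
      forall alpha, phi1 < alpha < PI / 2 ->
        local_min (T_Cl phi0 phi1 k) alpha \/
        local_max (T_Cl phi0 phi1 k) alpha ->
        alpha = alpha0) /\
   at_right phi1 (fun alpha =>
     T_Cl phi0 phi1 k alpha < T_upper_star phi0 phi1 k)) /\
  (* (e) *)
  (at_right phi1 (fun alpha =>
     T_A phi0 phi1 k alpha < T_lower_star phi0 phi1 k) /\
   convex_branch (type_A_branch phi0 phi1 k) /\
   filterlim (T_A phi0 phi1 k) (at_left (PI / 2)) (Rbar_locally p_infty) /\
   exists p, saddle_node (type_A_branch phi0 phi1 k) p /\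
     (forall q, type_A_branch phi0 phi1 k q -> fst p <= fst q) /\
     (forall q, saddle_node (type_A_branch phi0 phi1 k) q -> q = p)).
Proof.
  assert (Hphi : 0 < phi0 < phi1) by lra.
  assert (HkR : 1 <= INR k) by (apply le_INR in hk; exact hk).
  destruct (T1_T_bounds phi0 phi1 Hphi hphi1) as [B0 B1].
  split; [|split; [|split; [|split]]].
  - unfold T_upper_star, T_lower_star. rewrite plus_INR. simpl (INR 1). lra.
  - unfold T_upper_star, T_lower_star. lra.
  - intros alpha Ha. split; [now apply T_Cr_lower|now apply T_D_lower].
  - split; [now apply T_Cl_convex|split; [|split]].
    + apply (filterlim_amplitude phi1 (time_sum phi0 phi1 (4 * INR k + 2) (-1)));
        [lra| |].
      * apply time_sum_unbounded; lra.
      * intros alpha Ha. now apply T_Cl_time_sum.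
    + destruct (T_Cl_valley phi0 phi1 k Hphi hphi1) as [alpha0 V].
      exists alpha0. split; [apply (proj1 V)|].
      exact (valley_unique_extremum _ _ _ _ V).
    + apply (dip_at_right phi0 phi1 (4 * INR k + 2) (-1)); try lra.
      * intros alpha Ha. now apply T_Cl_time_sum.
      * now apply T_upper_star_limit.
  - assert (G : forall L y, type_A_branch phi0 phi1 k (L, y) <->
      speed_inf phi0 phi1 < y < speed_sup phi0 /\ L = half_time phi0 phi1 k y).
    { intros L y. now apply type_A_branch_graph. }
    destruct (half_time_valley phi0 phi1 k Hphi hphi1 hk) as [y0 V].
    split; [|split; [|split]].
    + apply (dip_at_right phi0 phi1 (4 * INR k) 1); try lra.
      * intros alpha Ha. now apply T_A_time_sum.
      * now apply T_lower_star_limit.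
    + exists (speed_inf phi0 phi1), (speed_sup phi0), (half_time phi0 phi1 k).
      split; [destruct V as [V _]; lra|split; [now apply half_time_convex|exact G]].
    + apply (filterlim_amplitude phi1 (time_sum phi0 phi1 (4 * INR k) 1)); [lra| |].
      * apply time_sum_unbounded; lra.
      * intros alpha Ha. now apply T_A_time_sum.
    + exists (half_time phi0 phi1 k y0, y0).
      exact (valley_saddle_node _ _ _ _ _ G V).
Qed.
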